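(* Let $\mu>-\frac12$ and $b>a>0$. Then the probability distribution on $(0,\infty)$ (the McKay distribution of type I) with probability density function $$\varphi_{\mu,a,b}(x)=\frac{\sqrt{\pi}\,(b^2-a^2)^{\mu+\frac{1}{2}}}{(2a)^{\mu}\,\Gamma\left(\mu+\frac{1}{2}\right)}\,x^{\mu}e^{-bx}I_{\mu}(ax),\qquad x>0,$$ is infinitely divisible, is self-decomposable, and is a generalized gamma convolution.
   Context: $I_\mu$ is the modified Bessel function of the first kind of order $\mu$, and $\Gamma$ is the Euler gamma function. A probability distribution $\nu$ on $[0,\infty)$ is infinitely divisible if for every $n\in\mathbb{N}$ there is a probability distribution $\nu_n$ on $[0,\infty)$ with $\int_0^\infty e^{-xt}d\nu(t)=\left[\int_0^\infty e^{-xt}d\nu_n(t)\right]^n$ for all $x>0$. A random variable $X$ (or its law) is self-decomposable if for every $c\in(0,1)$ there is a random variable $X_c$ independent of $X$ such that $X$ and $X_c+cX$ are equal in law. A probability distribution on $[0,\infty)$ is a generalized gamma convolution if its Laplace transform has the form $L(s)=\exp\left(-\alpha s+\int_0^\infty \ln\left(\frac{t}{s+t}\right)dm(t)\right)$, $s\ge 0$, with $\alpha\ge0$ and $m$ a non-negative measure. *)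

(* Defs.v *)
From mathcomp Require Import all_boot all_order all_algebra.
From mathcomp Require Import all_classical all_reals all_analysis.

Set Implicit Arguments.
Unset Strict Implicit.
Unset Printing Implicit Defensive.

Import Order.TTheory GRing.Theory Num.Theory.
Import numFieldNormedType.Exports.

Local Open Scope classical_set_scope.
Local Open Scope ring_scope.

Notation real_law R := (probability (measurableTypeR R) R).

(* Euler's integral: it represents the gamma function for 0 < z only, and
   carries no meaning elsewhere. *)
Definition Gamma (R : realType) (z : R) : R :=
  \int[lebesgue_measure]_(t in `]0, +oo[) (t `^ (z - 1) * expR (- t)).

(* I_mu(x) = \sum_n (x/2)^(2n + mu) / (n! Gamma(n + mu + 1)), used for x > 0.
   As [Gamma] is Euler's integral, this is the Bessel function only for orders
   mu > -1. *)
Definition besselI (R : realType) (mu x : R) : R :=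
  limn (series (fun n : nat =>
    (x / 2) `^ (n.*2%:R + mu) / (n`!%:R * Gamma (n%:R + mu + 1)))).

Definition mckay_pdf (R : realType) (mu a b x : R) : R :=
  Num.sqrt pi * (b ^+ 2 - a ^+ 2) `^ (mu + 2^-1)
    / ((2 * a) `^ mu * Gamma (mu + 2^-1))
  * x `^ mu * expR (- (b * x)) * besselI mu (a * x).

(* P is carried by D and has density f on D with respect to Lebesgue measure. *)
Definition has_density_on (R : realType) (D : set R) (f : R -> R) (P : real_law R) :
    Prop :=
  forall A : set R, measurable A ->
    P A = (\int[lebesgue_measure]_(x in A `&` D) (f x)%:E)%E.

Definition nonneg_law (R : realType) (P : real_law R) : Prop :=
  P `[0, +oo[%classic = 1%E.

Definition laplace (R : realType) (P : real_law R) (s : R) : \bar R :=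
  (\int[P]_(t in `[0%R, +oo[) (expR (- (s * t)))%:E)%E.

Definition infinitely_divisible (R : realType) (P : real_law R) : Prop :=
  nonneg_law P /\
  forall n : nat, (0 < n)%N ->
    exists2 Pn : real_law R, nonneg_law Pn &
      forall x : R, 0 < x -> laplace P x = (laplace Pn x ^+ n)%E.

Definition independent_RV d (T : measurableType d) (R : realType)
    (Q : probability T R) (X Y : {RV Q >-> R}) : Prop :=
  forall A B : set R, measurable A -> measurable B ->
    Q (X @^-1` A `&` Y @^-1` B) = (Q (X @^-1` A) * Q (Y @^-1` B))%E.

Definition has_law d (T : measurableType d) (R : realType)
    (Q : probability T R) (X : T -> R) (P : real_law R) : Prop :=
  forall A : set R, measurable A -> Q (X @^-1` A) = P A.

(* Self-decomposability of a law P: for every c, on a suitable probability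
   space there are X of law P and Xc independent of X such that Xc + c X also
   has law P. *)
Definition self_decomposable (R : realType) (P : real_law R) : Prop :=
  forall c : R, 0 < c < 1 ->
    exists (d : measure_display) (T : measurableType d) (Q : probability T R)
      (X Xc : {RV Q >-> R}),
      [/\ has_law Q X P,
          independent_RV X Xc
        & has_law Q (fun w => Xc w + c * X w) P].

(* The measure m lives on ]0, +oo[ (the integrand is -oo at t = 0 for s > 0,
   whereas [ln 0 = 0] here). The integrand is nonpositive and the left-hand
   side is nonzero, so the extended-real equation forces the integral to be
   finite. *)
Definition generalized_gamma_convolution (R : realType) (P : real_law R) : Prop :=
  nonneg_law P /\
  exists2 alpha : R, 0 <= alpha &
    exists m : {measure set (measurableTypeR R) -> \bar R},
      forall s : R, 0 <= s ->
        laplace P s =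
        expeR ((- (alpha * s))%:E
          + \int[m]_(t in `]0%R, +oo[) (ln (t / (s + t)))%:E)%E.

(* Main.v *)
(* With k = mu + 1/2, the McKay law is the law of X1 + X2 for independent
   X1 ~ Gamma(k, b - a) and X2 ~ Gamma(k, b + a). Substituting t = z (1 + w) / 2
   turns the convolution of the two gamma densities into Poisson's integral
   \int_{-1}^1 (1 - w^2)^(k - 1) cosh(a z w) dw; expanding cosh and computing the
   even moments of (1 - w^2)^(k - 1) gives the Bessel series.
   Infinite divisibility and the generalized gamma form are then read off the
   Laplace transform ((b - a) / (b - a + s))^k ((b + a) / (b + a + s))^k.
   Self-decomposability passes to sums, and for X ~ Gamma(k, r) it holds with
   Xc ~ Gamma(N, r / c) for a negative binomial N, by a comparison of densities;
   no uniqueness theorem for Laplace transforms is involved. *)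

From HB Require Import structures.
Require Import Defs.
From mathcomp Require Import all_boot all_order all_algebra.
From mathcomp Require Import all_classical all_reals all_analysis.
From mathcomp Require Import measurable_realfun ring lra.

Set Implicit Arguments.
Unset Strict Implicit.
Unset Printing Implicit Defensive.

Import Order.TTheory GRing.Theory Num.Theory.
Import numFieldNormedType.Exports.

Local Open Scope classical_set_scope.
Local Open Scope ring_scope.

(** * Change of variables and densities *)

(** The gamma, Beta and moment integrals have nonnegative integrands, take extended-real values and
    run over the whole line, with positivity of the variable built into [trunc_pow]. Tonelli and
    affine substitutions then apply without integrability conditions or changing bounds, and
    finiteness is proved only where a subtraction, a halving or a real value requires it. The factor
    sqrt(pi) of the density enters through the Gaussian integral, which evaluates the moment of
    order 0; the other even moments follow by a recurrence. The negative binomial comes from a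
    quotient of transforms. With q = (r/c) / (r/c + s), the transform of Gamma(1, r/c), the
    transforms of X and c X have quotient (c / (1 - (1 - c) q))^k, the generating function at q of
    the negative binomial law. This only suggests Xc; the proof checks the corresponding identity of
    densities. *)

Section change_of_variable.
Context {R : realType}.
Local Notation leb := (@lebesgue_measure R).
Local Open Scope ereal_scope.
Implicit Type f : R -> \bar R.

(** The image of Lebesgue measure under x -> c x + d, multiplied by c, gives each interval ]u, v]
    its length, hence is Lebesgue measure. *)
Lemma ge0_integral_affine (c d : R) f : (0 < c)%R ->
  measurable_fun setT f -> (forall x, 0 <= f x) ->
  \int[leb]_x f x = c%:E * \int[leb]_x f (c * x + d)%R.
Proof.
move=> c0 mf f0.
have mphi : measurable_fun setT
    ((fun x => c * x + d)%R : measurableTypeR R -> measurableTypeR R).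
  by apply: measurable_funD => //; apply: measurable_funM.
pose k := NngNum (ltW c0).
have := ge0_integral_pushforward mphi leb measurableT mf (fun y _ => f0 y).
rewrite preimage_setT/= => /esym fE.
rewrite [X in _ * X]fE -[c]/(k%:num)%R -ge0_integral_mscale//.
apply: eq_measure_integral => A mA _; apply: lebesgue_measure_unique => //.
move=> _ [[u v]] _ <- /=.
rewrite -[RHS]/(c%:E * leb ((fun x : R => (c * x + d)%R) @^-1` `]u, v])).
rewrite (_ : _ @^-1` _ = `]((u - d) / c)%R, ((v - d) / c)%R]%classic); last first.
  apply/seteqP; split => x; rewrite /= !in_itv/= ltr_pdivrMr//
    ler_pdivlMr// ltrBlDr lerBrDr (mulrC x)//.
rewrite !lebesgue_measure_itv/= !lte_fin ltr_pM2r ?invr_gt0// ltrD2r.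
case: ifPn => _; last by rewrite mule0.
by rewrite -!EFinB -EFinM; congr EFin; field; rewrite gt_eqF.
Qed.

Lemma ge0_integral_opp f :
  measurable_fun setT f -> (forall x, 0 <= f x) ->
  \int[leb]_x f x = \int[leb]_x f (- x)%R.
Proof.
move=> mf f0.
have mphi : measurable_fun setT
  (-%R : measurableTypeR R -> measurableTypeR R) by [].
have := ge0_integral_pushforward mphi leb measurableT mf (fun y _ => f0 y).
rewrite preimage_setT/= => <-.
by apply: eq_measure_integral => A mA _; exact/esym/lebesgue_measureN.
Qed.

End change_of_variable.

Section density.
Local Open Scope ereal_scope.
Context d {T : measurableType d} {R : realType}.
Variable m : {measure set T -> \bar R}.

Import HBNNSimple.

(** Monotone convergence reduces h to simple functions, and linearity reduces these to indicators,
    where the claim is the hypothesis on sets. *)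
Lemma ge0_integral_density (nu : {measure set T -> \bar R}) (f : T -> R)
    (h : T -> \bar R) :
  measurable_fun setT f -> (forall x, 0 <= f x)%R ->
  (forall A, measurable A -> nu A = \int[m]_(x in A) (f x)%:E) ->
  measurable_fun setT h -> (forall x, 0 <= h x) ->
  \int[nu]_x h x = \int[m]_x (h x * (f x)%:E).
Proof.
move=> mf f0 nuE mh h0; pose g := nnsfun_approx measurableT mh.
have hE x : h x = limn (fun n => (g n x)%:E).
  by apply/esym/cvg_lim => //; exact: cvg_nnsfun_approx.
transitivity (limn (fun n => \int[nu]_x (g n x)%:E)).
  under eq_integral do rewrite hE.
  apply: monotone_convergence => //.
  - by move=> n; exact/measurable_EFinP.
  - by move=> n x _; rewrite lee_fin.
  - by move=> x _ i j ij; rewrite lee_fin; exact/lefP/nd_nnsfun_approx.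
transitivity (limn (fun n => \int[m]_x ((g n x)%:E * (f x)%:E))); last first.
  rewrite -monotone_convergence//.
  - apply: eq_integral => x _; apply/cvg_lim => //.
    by apply: cvgeZr => //; exact: cvg_nnsfun_approx.
  - by move=> n; apply: emeasurable_funM; exact/measurable_EFinP.
  - by move=> n x _; rewrite mule_ge0// lee_fin.
  - move=> x _ i j ij; apply: lee_wpmul2r; rewrite lee_fin//.
    exact/lefP/nd_nnsfun_approx.
congr (limn _); apply/funext => n.
transitivity (\int[nu]_x
    (\sum_(y \in range (g n)) (y * \1_(g n @^-1` [set y]) x)%:E)).
  by apply: eq_integral => x _; rewrite fsumEFin// -fimfunE.
rewrite ge0_integral_fsum//; last 2 first.
- by move=> y; exact/measurable_EFinP/measurable_funM.
- by move=> y x _; exact: nnfun_muleindic_ge0.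
transitivity (\int[m]_x
    (\sum_(y \in range (g n)) (y * \1_(g n @^-1` [set y]) x)%:E * (f x)%:E)).
  rewrite ge0_integral_fsum//; last 2 first.
  - move=> y; apply: emeasurable_funM; apply/measurable_EFinP => //.
    exact: measurable_funM.
  - by move=> y x _; rewrite mule_ge0 ?lee_fin//; exact: nnfun_muleindic_ge0.
  apply: eq_fsbigr => r /[!inE] -[t _ <-].
  under eq_integral do rewrite EFinM.
  rewrite integralZl_indic_nnsfun// integral_indic// setIT.
  under [RHS]eq_integral do rewrite EFinM -muleA.
  rewrite [RHS]ge0_integralZl//; last first.
  - by rewrite lee_fin.
  - by move=> x _; rewrite mule_ge0// lee_fin.
  - by apply: emeasurable_funM; exact/measurable_EFinP.
  congr (_ * _); rewrite nuE// [LHS]integral_mkcond.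
  by apply: eq_integral => x _; rewrite epatch_indic muleC.
apply: eq_integral => x _; rewrite -ge0_mule_fsuml.
  by rewrite fsumEFin// -fimfunE.
by move=> y; exact: nnfun_muleindic_ge0.
Qed.

End density.

(** * Gamma and Beta integrals *)

Section gamma_beta.
Context {R : realType}.
Local Notation leb := (@lebesgue_measure R).
Implicit Types k p q x z : R.

(** This is x_+^(k - 1). The cutoff is written out because [powR] does not vanish at negative
    reals. *)
Definition trunc_pow k x : R := if 0 < x then x `^ (k - 1) else 0.

Lemma trunc_pow_ge0 k x : 0 <= trunc_pow k x.
Proof. by rewrite /trunc_pow; case: ifP => // _; exact: powR_ge0. Qed.

Lemma trunc_pow_gt0 k x : 0 < x -> trunc_pow k x = x `^ (k - 1).
Proof. by rewrite /trunc_pow => ->. Qed.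

Lemma trunc_pow_le0 k x : x <= 0 -> trunc_pow k x = 0.
Proof. by rewrite /trunc_pow ltNge => ->. Qed.

Lemma measurable_trunc_pow k : measurable_fun setT (trunc_pow k).
Proof.
apply: measurable_fun_ifT.
- exact: measurable_fun_ltr.
- exact: measurable_powR.
- exact: measurable_cst.
Qed.

Lemma trunc_powS k x : trunc_pow (k + 1) x = x * trunc_pow k x.
Proof.
rewrite /trunc_pow; case: ifPn => x0; last by rewrite mulr0.
rewrite -[X in _ = X * _](powRr1 (ltW x0)) -powRD; last by rewrite (gt_eqF x0) implybT.
by congr (_ `^ _); ring.
Qed.

Lemma trunc_powZ k c x : 0 < c ->
  trunc_pow k (c * x) = c `^ (k - 1) * trunc_pow k x.
Proof.
move=> c0; rewrite /trunc_pow pmulr_rgt0//; case: ifPn => x0; last by rewrite mulr0.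
by rewrite powRM// ltW.
Qed.

Lemma trunc_powM p q z : trunc_pow p z * trunc_pow q z * z = trunc_pow (p + q) z.
Proof.
rewrite /trunc_pow; case: ifPn => z0; last by rewrite !mul0r.
rewrite -[X in _ * X](powRr1 (ltW z0)) -!powRD ?(gt_eqF z0) ?implybT//.
by congr (_ `^ _); ring.
Qed.

Local Open Scope ereal_scope.

(** Extended-real values postpone finiteness: the functional equations come first, and [eGamma_lty]
    is deduced from them. *)
Definition eGamma k : \bar R := \int[leb]_x (trunc_pow k x * expR (- x))%:E.

Definition eBeta p q : \bar R :=
  \int[leb]_u (trunc_pow p u * trunc_pow q (1 - u))%:E.

Lemma fine_eGamma k : fine (eGamma k) = Gamma k.
Proof.
rewrite /Gamma /Rintegral; congr fine; rewrite [RHS]integral_mkcond.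
apply: eq_integral => x _; rewrite patchE; case: ifPn.
  by rewrite inE/= in_itv/= andbT => x0; rewrite trunc_pow_gt0.
rewrite notin_setE/= in_itv/= andbT => /negP; rewrite -leNgt => x0.
by rewrite trunc_pow_le0// mul0r.
Qed.

(** Homogeneity: t = z u extracts z^(p - 1), z^(q - 1) and the Jacobian z. *)
Lemma integral_trunc_powM p q z :
  \int[leb]_t (trunc_pow p t * trunc_pow q (z - t))%:E =
  (trunc_pow (p + q) z)%:E * eBeta p q.
Proof.
have [z0|z0] := ltP 0%R z; last first.
  rewrite trunc_pow_le0// mul0e integral0_eq// => t _.
  have [t0|t0] := ltP 0%R t; last by rewrite trunc_pow_le0// mul0r.
  by rewrite [X in (_ * X)%R]trunc_pow_le0 ?mulr0//; lra.
have mpq c : measurable_fun setT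
    (fun t : measurableTypeR R => (trunc_pow p t * trunc_pow q (c - t))%:E).
  apply/measurable_EFinP; apply: measurable_funM; first exact: measurable_trunc_pow.
  apply: (measurableT_comp (measurable_trunc_pow q)).
  exact: measurable_funB.
have pq0 c t : 0 <= (trunc_pow p t * trunc_pow q (c - t))%:E.
  by rewrite lee_fin mulr_ge0// trunc_pow_ge0.
have mpqz : measurable_fun setT (fun w : measurableTypeR R =>
    (trunc_pow p (z * w + 0) * trunc_pow q (z - (z * w + 0)))%:E).
  apply: (measurableT_comp (mpq z)).
  by apply: measurable_funD => //; exact: measurable_funM.
have z0e : 0 <= z%:E by rewrite lee_fin ltW.
have zpq0 : 0 <= (trunc_pow (p + q) z)%:E by rewrite lee_fin trunc_pow_ge0.
rewrite (ge0_integral_affine 0 z0 (mpq z) (pq0 z)) /eBeta.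
rewrite -(ge0_integralZl _ measurableT mpqz _ z0e); last first.
  by move=> t _; exact: pq0.
rewrite -(ge0_integralZl _ measurableT (mpq 1%R) _ zpq0); last first.
  by move=> t _; exact: pq0.
apply: eq_integral => u _; rewrite -!EFinM; congr EFin.
rewrite addr0 (_ : z - z * u = z * (1 - u))%R; last by ring.
rewrite !trunc_powZ// -trunc_powM !(trunc_pow_gt0 _ z0); ring.
Qed.

(** With y = z - x, the double integral of x^(p - 1) y^(q - 1) e^(-x - y) is taken first in x at
    fixed z, where e^(-z) is constant and [integral_trunc_powM] applies. *)
Lemma eGammaM p q : eGamma p * eGamma q = eGamma (p + q) * eBeta p q.
Proof.
have m1 k : measurable_fun setT (fun x => trunc_pow k x * expR (- x))%R.
  apply: measurable_funM; first exact: measurable_trunc_pow.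
  exact: measurableT_comp.
have ge1 k x : (0 <= trunc_pow k x * expR (- x))%R.
  by rewrite mulr_ge0 ?trunc_pow_ge0 ?expR_ge0.
have eG0 k : 0 <= eGamma k by apply: integral_ge0 => x _; rewrite lee_fin.
rewrite {1}/eGamma -ge0_integralZr//; last 2 first.
- by apply/measurable_EFinP; exact: m1.
- by move=> x _; rewrite lee_fin.
transitivity (\int[leb]_x \int[leb]_z
   (trunc_pow p x * trunc_pow q (z - x) * expR (- z))%:E).
  apply: eq_integral => x _; rewrite -ge0_integralZl//; last 3 first.
  - by apply/measurable_EFinP; exact: m1.
  - by move=> y _; rewrite lee_fin.
  - by rewrite lee_fin.
  rewrite [LHS](ge0_integral_affine (- x)%R ltr01)//; last 2 first.
  - by apply: emeasurable_funM => //; apply/measurable_EFinP; exact: m1.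
  - by move=> y; rewrite -EFinM lee_fin mulr_ge0.
  rewrite mul1e; apply: eq_integral => z _; rewrite -EFinM mul1r; congr EFin.
  rewrite (_ : expR (- z) = expR (- x) * expR (- (z - x)))%R; first by ring.
  by rewrite -expRD; congr expR; ring.
have m2 : measurable_fun setT (fun xz : measurableTypeR R * measurableTypeR R =>
    (trunc_pow p xz.1 * trunc_pow q (xz.2 - xz.1) * expR (- xz.2))%:E).
  apply/measurable_EFinP; apply: measurable_funM; first apply: measurable_funM.
  - exact: (measurableT_comp (measurable_trunc_pow p)).
  - apply: (measurableT_comp (measurable_trunc_pow q)).
    exact: measurable_funB.
  - by apply: (measurableT_comp (@measurable_expR R)); exact: measurableT_comp.
rewrite (fubini_tonelli _ m2)/=; last first.
  by move=> xz; rewrite lee_fin !mulr_ge0 ?trunc_pow_ge0 ?expR_ge0.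
rewrite [in RHS]/eGamma -ge0_integralZr//; last 3 first.
- by apply/measurable_EFinP; exact: m1.
- by move=> y _; rewrite lee_fin.
- by apply: integral_ge0 => u _; rewrite lee_fin mulr_ge0 ?trunc_pow_ge0.
apply: eq_integral => z _; rewrite EFinM muleAC -integral_trunc_powM.
under eq_integral do rewrite EFinM.
rewrite ge0_integralZr ?lee_fin ?expR_ge0//.
- apply/measurable_EFinP/measurable_funM; first exact: measurable_trunc_pow.
  apply: (measurableT_comp (measurable_trunc_pow q)).
  exact: measurable_funB.
- by move=> y _; rewrite lee_fin mulr_ge0 ?trunc_pow_ge0.
Qed.

Lemma eGamma1 : eGamma 1 = 1.
Proof.
rewrite /eGamma -(integral_exponential_pdf (ltr01 : 0 < 1 :> R)%R).
transitivity (\int[leb]_(x in `]0%R, +oo[) (expR (- x))%:E).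
  rewrite [RHS]integral_mkcond; apply: eq_integral => x _; rewrite patchE.
  case: ifPn; rewrite ?notin_setE ?inE/= in_itv/= andbT.
    by move=> x0; rewrite trunc_pow_gt0// subrr powRr0 mul1r.
  by move/negP; rewrite -leNgt => x0; rewrite trunc_pow_le0// mul0r.
rewrite integral_itv_obnd_cbnd; last first.
  by apply/measurable_EFinP/measurable_funTS; exact: measurableT_comp.
rewrite integral_mkcond; apply: eq_integral => x _.
rewrite /exponential_pdf !patchE; case: ifP => // _.
by rewrite mul1r mulN1r.
Qed.

(** For k < 1 the integrand is unbounded at 0, so the fundamental theorem of calculus is applied on
    [1/(n+1), 1] and n tends to infinity. *)
Lemma eBetax1 k : (0 < k)%R -> eBeta k 1 = (k^-1)%:E.
Proof.
move=> k0.
pose F n := `[(n.+1%:R^-1)%R, 1%R : R]%classic.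
pose f u := ((u : R) `^ (k - 1))%:E.
have mf (D : set R) : measurable_fun D f.
  by apply/measurable_EFinP/measurable_funTS; exact: measurable_powR.
transitivity (\int[leb]_(u in `]0%R, 1%R[) f u).
  rewrite [RHS]integral_mkcond; apply: eq_integral => x _; rewrite patchE.
  case: ifPn; rewrite ?notin_setE ?inE/= in_itv/=.
    move=> /andP[x0 x1]; rewrite !trunc_pow_gt0 ?subr_gt0//.
    by rewrite subrr powRr0 mulr1.
  move=> /negP; rewrite negb_and -!leNgt => /orP[x0|x1].
    by rewrite trunc_pow_le0// mul0r.
  by rewrite [X in (_ * X)%R]trunc_pow_le0 ?subr_le0// mulr0.
rewrite integral_itv_bndo_bndc//.
have <- : \bigcup_n F n = `]0%R, 1%R]%classic.
  apply/seteqP; split => [x [n _]|x]; rewrite /F/= !in_itv/=.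
    move=> /andP[+ ->]; rewrite andbT; apply: lt_le_trans.
    by rewrite invr_gt0.
  move=> /andP[x0 x1].
  have [n nx] : exists n, (n.+1%:R^-1 <= x)%R.
    exists (Num.truncn x^-1); rewrite -[leRHS]invrK lef_pV2 ?posrE ?invr_gt0//.
    by rewrite ltW// truncnS_gt.
  by exists n => //; rewrite /F/= in_itv/= nx.
have FE n : \int[leb]_(u in F n) f u = ((1 - n.+1%:R^-1 `^ k) / k)%:E.
  (* For n = 0 the interval is the single point 1, to which the fundamental theorem does not
     apply. *)
  case: n => [|n].
    by rewrite /F invr1 set_itv1 integral_set1 powR1 subrr mul0r.
  have n1 : (n.+2%:R^-1 < 1 :> R)%R by rewrite invf_lt1 ?ltr1n.
  have n0 : (0 < n.+2%:R^-1 :> R)%R by rewrite invr_gt0.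
  have dF x : (0 < x)%R ->
      is_derive x 1%R (fun u : R => (u `^ k / k)%R) (x `^ (k - 1))%R.
    move=> x0; have := is_derive1_powR k x0 => dx.
    apply: is_derive_eq.
    by rewrite scaler0 add0r/= -[LHS]/(_ * _)%R; field; rewrite gt_eqF.
  have cG x : (0 < x)%R -> {for x, continuous (fun u : R => (u `^ k / k)%R)}.
    move=> x0; apply: differentiable_continuous; apply/derivable1_diffP.
    by have [] := dF _ x0.
  rewrite /F (@continuous_FTC2 _ _ (fun u => (u `^ k / k)%R))//.
  - by rewrite powR1 -EFinB mulrBl.
  - apply: derivable_within_continuous => x; rewrite in_itv/= => /andP[x0 _].
    by apply: derivable_powR; rewrite in_itv/= andbT (lt_le_trans n0).
  - split => [x||].
    + rewrite in_itv/= => /andP[x0 _].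
      by have [] := dF _ (lt_trans n0 x0).
    + exact/cvg_at_right_filter/cG.
    + exact/cvg_at_left_filter/cG/ltr01.
  - move=> x; rewrite in_itv/= => /andP[x0 _].
    by rewrite derive1E; have [_ ->] := dF _ (lt_trans n0 x0).
have c1 : \int[leb]_(u in F n) f u @[n --> \oo] -->
    \int[leb]_(u in \bigcup_n F n) f u.
  apply: ge0_nondecreasing_set_cvg_integral => //.
  - apply/nondecreasing_seqP => n; rewrite subsetEset => x; rewrite /F/= !in_itv/=.
    move=> /andP[+ ->]; rewrite andbT; apply: le_trans.
    by rewrite lef_pV2 ?posrE// ler_nat.
  - by move=> n; exact: measurable_itv.
  - by move=> n; exact: mf.
  - by move=> n x _; rewrite lee_fin powR_ge0.
rewrite -(cvg_lim _ c1)//; apply/cvg_lim => //.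
under eq_fun do rewrite FE.
apply: cvg_EFin; first by apply: nearW.
rewrite [X in _ --> X](_ : _ = (1 - 0) / k)%R; last by rewrite subr0 div1r.
change ((1 - n.+1%:R^-1 `^ k) / k @[n --> \oo] --> (1 - 0) / k)%R.
apply: cvgM; last exact: cvg_cst.
apply: cvgB; first exact: cvg_cst.
have /cvg_at_rightP := powR_cvg0 k0; apply; split; last exact: cvg_harmonic.
by move=> n; rewrite invr_gt0.
Qed.

(** The case q = 1 of [eGammaM], in place of an integration by parts. *)
Lemma eGammaS k : (0 < k)%R -> eGamma (k + 1) = k%:E * eGamma k.
Proof.
move=> k0; have := eGammaM k 1; rewrite eGamma1 mule1 eBetax1// => ->.
by rewrite muleCA -EFinM divff ?gt_eqF// mule1.
Qed.

End gamma_beta.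

(** * Finiteness and positivity of Gamma, even moments of (1 - w^2)^(k - 1) *)

Section gamma_theory.
Context {R : realType}.
Local Notation leb := (@lebesgue_measure R).
Implicit Types k x : R.
Local Open Scope ereal_scope.

Lemma measurable_gamma_integrand k :
  measurable_fun setT (fun x => trunc_pow k x * expR (- x))%R.
Proof.
apply: measurable_funM; first exact: measurable_trunc_pow.
exact: measurableT_comp.
Qed.

Lemma gamma_integrand_ge0 k x : (0 <= trunc_pow k x * expR (- x))%R.
Proof. by rewrite mulr_ge0 ?trunc_pow_ge0 ?expR_ge0. Qed.

Lemma eGamma_ge0 k : 0 <= eGamma k.
Proof. by apply: integral_ge0 => x _; rewrite lee_fin gamma_integrand_ge0. Qed.

(** For k <= 1 the integrand is at most x^(k - 1) on ]0, 1[ and e^(-x) beyond, that is, at most the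
    sum of the integrands of [eBeta k 1] and [eGamma 1], whose values are known. The recurrence
    reaches larger k. *)
Lemma eGamma_lty k : (0 < k)%R -> eGamma k < +oo.
Proof.
move=> k0; have [n] : exists n, (k <= n.+1%:R)%R.
  by exists (Num.truncn k); rewrite ltW// truncnS_gt.
elim: n k k0 => [k k0 k1|n IHn k k0 kn]; last first.
  have [k1|k1] := leP k 1%R.
    by apply: IHn => //; rewrite (le_trans k1)// ler1n.
  rewrite -(subrK 1%R k) eGammaS ?subr_gt0// lte_mul_pinfty ?lee_fin//.
    by rewrite subr_ge0 ltW.
  by apply: IHn; rewrite ?subr_gt0// lerBlDr natr1.
apply: (@le_lt_trans _ _ (eBeta k 1 + eGamma 1)); last first.
  by rewrite eBetax1// eGamma1 -EFinD ltry.
have mB : measurable_fun setT (fun u => (trunc_pow k u * trunc_pow 1 (1 - u))%R).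
  apply: measurable_funM; first exact: measurable_trunc_pow.
  by apply: (measurableT_comp (measurable_trunc_pow 1)); exact: measurable_funB.
have mG := measurable_gamma_integrand.
rewrite /eBeta /eGamma -ge0_integralD//; last 4 first.
- by move=> x _; rewrite lee_fin mulr_ge0 ?trunc_pow_ge0.
- by apply/measurable_EFinP; exact: mB.
- by move=> x _; rewrite lee_fin gamma_integrand_ge0.
- by apply/measurable_EFinP; exact: mG.
apply: ge0_le_integral => //.
- by move=> x _; rewrite lee_fin gamma_integrand_ge0.
- by apply/measurable_EFinP; exact: mG.
- by apply: emeasurable_funD; apply/measurable_EFinP; [exact: mB|exact: mG].
move=> x _; rewrite -EFinD lee_fin.
have [x0|x0] := leP x 0%R; first by rewrite !(trunc_pow_le0 _ x0) !mul0r addr0.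
have [x1|x1] := ltP x 1%R.
  apply: ler_wpDr; first exact: gamma_integrand_ge0.
  rewrite [X in (_ <= _ * X)%R]trunc_pow_gt0 ?subr_gt0// subrr powRr0.
  by rewrite ler_wpM2l ?trunc_pow_ge0// -expR0 ler_expR oppr_le0 ltW.
apply: ler_wpDl; first by rewrite mulr_ge0 ?trunc_pow_ge0.
rewrite ler_wpM2r ?expR_ge0// !trunc_pow_gt0// subrr powRr0.
by rewrite -[leRHS](powRr0 x) ler_powR// subr_le0.
Qed.

Lemma eGammaE k : (0 < k)%R -> eGamma k = (Gamma k)%:E.
Proof.
by move=> k0; rewrite -fine_eGamma fineK// ge0_fin_numE ?eGamma_ge0// eGamma_lty.
Qed.

Lemma GammaS k : (0 < k)%R -> (Gamma (k + 1) = k * Gamma k)%R.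
Proof.
move=> k0; have := eGammaS k0; rewrite !eGammaE//; last exact: addr_gt0.
by rewrite -EFinM => -[].
Qed.

(** Passing to k + 1 makes the exponent positive, so that x^k e^(-x) >= e^(-2) on [1, 2]. *)
Lemma Gamma_gt0 k : (0 < k)%R -> (0 < Gamma k)%R.
Proof.
move=> k0; rewrite -(pmulr_rgt0 _ k0) -GammaS// -lte_fin -eGammaE ?addr_gt0//.
apply: (@lt_le_trans _ _ (\int[leb]_(x in `[1%R, 2%R]) (expR (- 2))%:E)).
  rewrite integral_cst//= lebesgue_measure_itv/= lte_fin ltr1n.
  by rewrite -EFinB -EFinM lte_fin mulr_gt0 ?expR_gt0//; lra.
rewrite integral_mkcond; apply: ge0_le_integral => //.
- by move=> x _; rewrite patchE; case: ifP => // _; rewrite lee_fin expR_ge0.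
- by apply/(measurable_restrictT (cst (expR (- 2))%:E)) => //; exact: measurable_cst.
- by apply/measurable_EFinP; exact: measurable_gamma_integrand.
move=> x _; rewrite patchE; case: ifPn => [|_]; last first.
  by rewrite lee_fin gamma_integrand_ge0.
rewrite inE/= in_itv/= => /andP[x1 x2]; rewrite lee_fin trunc_pow_gt0; last lra.
rewrite addrK -[leLHS]mul1r ler_pM ?expR_ge0//; last by rewrite ler_expR lerN2.
by rewrite -(powRr0 x) ler_powR// ltW.
Qed.

(* Up to normalization, the moment of order 2n of a coordinate of a uniform point
   on the unit sphere of dimension 2k. *)
Definition sphere_moment (n : nat) k : \bar R :=
  \int[leb]_w (trunc_pow k (1 - w ^+ 2) * w ^+ n.*2)%:E.

Lemma measurable_trunc_pow_sqr k t :
  measurable_fun setT (fun w : R => trunc_pow k (t - w ^+ 2)).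
Proof.
apply: (measurableT_comp (measurable_trunc_pow k)).
by apply: measurable_funB => //; exact: measurable_funX.
Qed.

(** Substituting y = t^(1/2) w extracts t^(k - 1) from the integrand and t^(1/2) from the
    measure. *)
Lemma integral_trunc_pow_sqr k t :
  \int[leb]_y (trunc_pow k (t - y ^+ 2))%:E =
  (trunc_pow (k + 2^-1) t)%:E * sphere_moment 0 k.
Proof.
have [t0|t0] := ltP 0%R t; last first.
  rewrite [in RHS]trunc_pow_le0// mul0e integral0_eq// => y _.
  by rewrite trunc_pow_le0//; have := sqr_ge0 y; lra.
have st0 : (0 < t `^ 2^-1)%R by rewrite powR_gt0.
rewrite (ge0_integral_affine 0 st0)//; last 2 first.
- by apply/measurable_EFinP; exact: measurable_trunc_pow_sqr.
- by move=> y; rewrite lee_fin trunc_pow_ge0.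
rewrite /sphere_moment -ge0_integralZl//; last 3 first.
- apply/measurable_EFinP.
  apply: (measurableT_comp (measurable_trunc_pow_sqr k t)).
  by apply: measurable_funD => //; exact: measurable_funM.
- by move=> y _; rewrite lee_fin trunc_pow_ge0.
- by rewrite lee_fin ltW.
rewrite -ge0_integralZl//; last 3 first.
- apply/measurable_EFinP; apply: measurable_funM => //.
  exact: measurable_trunc_pow_sqr.
- by move=> y _; rewrite lee_fin mulr_ge0 ?trunc_pow_ge0.
- by rewrite lee_fin trunc_pow_ge0.
apply: eq_integral => w _; rewrite -!EFinM addr0 mulr1; congr EFin.
rewrite (_ : t - _ = t * (1 - w ^+ 2))%R; last first.
  by rewrite powR12_sqrt ?ltW// exprMn sqr_sqrtr ?ltW//; ring.
rewrite trunc_powZ// mulrA -powRD ?(gt_eqF t0) ?implybT// (trunc_pow_gt0 _ t0).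
by congr (_ `^ _ * _)%R; ring.
Qed.

(* Legendre's duplication formula in disguise: the function
   (t - y^2)_+^(k-1) e^(-t) is integrated over the plane in both orders. *)
Lemma eGamma_sphere_moment0 k :
  eGamma (k + 2^-1) * sphere_moment 0 k = (Num.sqrt pi)%:E * eGamma k.
Proof.
have sm0 : 0 <= sphere_moment 0 k.
  by apply: integral_ge0 => w _; rewrite lee_fin mulr_ge0 ?trunc_pow_ge0.
rewrite {1}/eGamma -ge0_integralZr//; last 2 first.
- by apply/measurable_EFinP; exact: measurable_gamma_integrand.
- by move=> x _; rewrite lee_fin gamma_integrand_ge0.
transitivity (\int[leb]_t \int[leb]_y
   (trunc_pow k (t - y ^+ 2) * expR (- t))%:E).
  apply: eq_integral => t _; rewrite EFinM muleAC -integral_trunc_pow_sqr.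
  under [RHS]eq_integral do rewrite EFinM.
  rewrite ge0_integralZr ?lee_fin ?expR_ge0//.
  - by apply/measurable_EFinP; exact: measurable_trunc_pow_sqr.
  - by move=> y _; rewrite lee_fin trunc_pow_ge0.
have m2 : measurable_fun setT (fun ty : measurableTypeR R * measurableTypeR R =>
    (trunc_pow k (ty.1 - ty.2 ^+ 2) * expR (- ty.1))%:E).
  apply/measurable_EFinP; apply: measurable_funM.
  - apply: (measurableT_comp (measurable_trunc_pow k)).
    by apply: measurable_funB => //; exact: measurable_funX.
  - by apply: (measurableT_comp (@measurable_expR R)); exact: measurableT_comp.
rewrite (fubini_tonelli _ m2)/=; last first.
  by move=> ty; rewrite lee_fin !mulr_ge0 ?trunc_pow_ge0 ?expR_ge0.
rewrite -integralT_gauss -ge0_integralZr//; last 3 first.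
- by apply/measurable_EFinP; exact: measurable_gauss_fun.
- by move=> y _; rewrite lee_fin gauss_fun_ge0.
- exact: eGamma_ge0.
apply: eq_integral => y _.
have mt : measurable_fun setT
    (fun t : measurableTypeR R => (trunc_pow k (t - y ^+ 2) * expR (- t))%:E).
  apply/measurable_EFinP; apply: measurable_funM.
  + apply: (measurableT_comp (measurable_trunc_pow k)).
    exact: measurable_funB.
  + exact: measurableT_comp.
have t0 t : 0 <= (trunc_pow k (t - y ^+ 2) * expR (- t))%:E.
  by rewrite lee_fin mulr_ge0 ?trunc_pow_ge0 ?expR_ge0.
rewrite [LHS](ge0_integral_affine (y ^+ 2) ltr01 mt t0).
rewrite mul1e /eGamma -ge0_integralZl//; last 3 first.
- by apply/measurable_EFinP; exact: measurable_gamma_integrand.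
- by move=> x _; rewrite lee_fin gamma_integrand_ge0.
- by rewrite lee_fin gauss_fun_ge0.
apply: eq_integral => t _; rewrite -EFinM mul1r addrK; congr EFin.
by rewrite /gauss_fun mulrCA -expRD opprD addrC.
Qed.

(** Integrates the identity 1 = w^2 + (1 - w^2) against the integrand of the left-hand side. *)
Lemma sphere_moment_rec n k :
  sphere_moment n k = sphere_moment n.+1 k + sphere_moment n (k + 1).
Proof.
have e0 m (w : R) : (0 <= w ^+ m.*2)%R by rewrite exprn_even_ge0// odd_double.
have m0 m l : measurable_fun setT (fun w : R => trunc_pow l (1 - w ^+ 2) * w ^+ m.*2)%R.
  apply: measurable_funM; first exact: measurable_trunc_pow_sqr.
  exact: measurable_funX.
rewrite /sphere_moment -ge0_integralD//.
- apply: eq_integral => w _; rewrite -EFinD trunc_powS doubleS !exprS; congr EFin.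
  ring.
- by move=> w _; rewrite lee_fin mulr_ge0// trunc_pow_ge0.
- by apply/measurable_EFinP; exact: m0.
- by move=> w _; rewrite lee_fin mulr_ge0// trunc_pow_ge0.
- by apply/measurable_EFinP; exact: m0.
Qed.

(** The recurrence lowers n at the price of k + 1, so the induction on n is for all k at once. It
    also supplies the finiteness of [sphere_moment n (k + 1)], which makes the subtraction
    legitimate. *)
Lemma sphere_momentE n k : (0 < k)%R -> sphere_moment n k =
  (Num.sqrt pi * (n.*2`!%:R / (4 ^+ n * n`!%:R)) *
    (Gamma k / Gamma (n%:R + k + 2^-1)))%:E.
Proof.
elim: n k => [|n IHn] k k0.
  have k20 : (0 < k + 2^-1)%R by rewrite addr_gt0.
  have := eGamma_sphere_moment0 k; rewrite !eGammaE//.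
  move=> /(congr1 (mule (Gamma (k + 2^-1))^-1%:E)).
  rewrite muleA -!EFinM mulVf ?gt_eqF ?Gamma_gt0// mul1e => ->.
  by congr EFin; rewrite fact0 expr0 mulr1 divr1 mulr1 add0r mulrC mulrA.
have k10 : (0 < k + 1)%R by rewrite addr_gt0.
have nk0 : (0 < n%:R + k + 2^-1)%R.
  by have := ler0n R n; lra.
have := sphere_moment_rec n k; rewrite !IHn// => /eqP.
rewrite -sube_eq// => [/eqP <-|]; last exact: fin_num_adde_defl.
rewrite -EFinB; congr EFin.
have -> : (n%:R + (k + 1) + 2^-1 = n%:R + k + 2^-1 + 1)%R by ring.
have -> : (n.+1%:R + k + 2^-1 = n%:R + k + 2^-1 + 1)%R by rewrite -natr1; ring.
rewrite !GammaS// doubleS !factS !natrM exprS.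
have -> : (n.*2.+2%:R = 2 * (n%:R + 1) :> R)%R.
  by rewrite natr1 -natrM mul2n doubleS.
have -> : (n.*2.+1%:R = 2 * n%:R + 1 :> R)%R by rewrite -natrM natr1 mul2n.
rewrite -(natr1 n).
have G0 := Gamma_gt0 nk0; set G := Gamma (_ + _ + _) in G0 *.
have f0 : (0 < n`!%:R :> R)%R by rewrite ltr0n fact_gt0.
have p0 : (0 < 4 ^+ n :> R)%R by rewrite exprn_gt0.
have n0 : (0 < n%:R + 1 :> R)%R by rewrite natr1.
set f := (n`!%:R)%R in f0 *; set f2 := (n.*2`!%:R)%R; set q := (4 ^+ n)%R in p0 *.
set m := (n%:R)%R in nk0 n0 *.
by field; rewrite !gt_eqF//= -/m; lra.
Qed.

End gamma_theory.

(** * Gamma densities, laws and convolution *)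

Section gamma_pdf.
Context {R : realType}.
Local Notation leb := (@lebesgue_measure R).
Implicit Types k p q r s c x z : R.

Definition gamma_pdf k r x : R :=
  r `^ k / Gamma k * trunc_pow k x * expR (- (r * x)).

Lemma measurable_gamma_pdf k r : measurable_fun setT (gamma_pdf k r).
Proof.
apply: measurable_funM.
  by apply: measurable_funM => //; exact: measurable_trunc_pow.
apply: (measurableT_comp (@measurable_expR R)).
by apply: measurableT_comp => //; exact: measurable_funM.
Qed.

Lemma gamma_pdf_ge0 k r x : 0 < k -> 0 <= gamma_pdf k r x.
Proof.
move=> k0; rewrite !mulr_ge0 ?expR_ge0 ?trunc_pow_ge0 ?powR_ge0//.
by rewrite invr_ge0 ltW// Gamma_gt0.
Qed.

Lemma gamma_pdf_le0 k r x : x <= 0 -> gamma_pdf k r x = 0.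
Proof. by move=> x0; rewrite /gamma_pdf trunc_pow_le0// mulr0 mul0r. Qed.

(** The left-hand side is the density of c X for X ~ Gamma(k, r): scaling by c divides the rate by
    c. *)
Lemma gamma_pdfZ k r c x : 0 < r -> 0 < c ->
  c^-1 * gamma_pdf k r (c^-1 * x) = gamma_pdf k (r / c) x.
Proof.
move=> r0 c0; have c'0 : 0 < c^-1 by rewrite invr_gt0.
rewrite /gamma_pdf trunc_powZ// powRM ?ltW//.
have -> : c^-1 `^ k = c^-1 * c^-1 `^ (k - 1).
  rewrite -[X in _ = X * _](powRr1 (ltW c'0)) -powRD ?(gt_eqF c'0) ?implybT//.
  by congr (_ `^ _); ring.
by rewrite mulrA (_ : r / c * x = r * (c^-1 * x)); ring.
Qed.

Local Open Scope ereal_scope.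

Lemma laplace_gamma_pdf k r s : (0 < k)%R -> (0 < r)%R -> (0 <= s)%R ->
  \int[leb]_x (expR (- (s * x)) * gamma_pdf k r x)%:E = ((r / (r + s)) `^ k)%:E.
Proof.
move=> k0 r0 s0; have rs0 : (0 < r + s)%R by rewrite ltr_wpDr.
have c0 : (0 < (r + s)^-1)%R by rewrite invr_gt0.
have mi : measurable_fun setT (fun x => expR (- (s * x)) * gamma_pdf k r x)%R.
  apply: measurable_funM; last exact: measurable_gamma_pdf.
  apply: (measurableT_comp (@measurable_expR R)).
  by apply: measurableT_comp => //; exact: measurable_funM.
rewrite (ge0_integral_affine 0 c0)//; last 2 first.
- by apply/measurable_EFinP; exact: mi.
- by move=> x; rewrite lee_fin mulr_ge0 ?expR_ge0 ?gamma_pdf_ge0.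
set c := (r + s)^-1%R in c0 *.
transitivity (\int[leb]_x
    ((r `^ k / Gamma k * c `^ (k - 1))%:E * (trunc_pow k x * expR (- x))%:E) * c%:E).
  rewrite muleC; apply: (congr1 (mule^~ c%:E)); apply: eq_integral => x _.
  rewrite -EFinM; congr EFin.
  rewrite addr0 /gamma_pdf trunc_powZ//.
  rewrite (_ : expR (- x) = expR (- (s * (c * x))) * expR (- (r * (c * x))))%R.
    by ring.
  by rewrite -expRD; congr expR; rewrite /c; field; rewrite gt_eqF.
rewrite ge0_integralZl//; last 3 first.
- by apply/measurable_EFinP; exact: measurable_gamma_integrand.
- by move=> x _; rewrite lee_fin gamma_integrand_ge0.
- by rewrite lee_fin !mulr_ge0 ?powR_ge0// invr_ge0 ltW// Gamma_gt0.
rewrite -/(eGamma k) eGammaE// -!EFinM; congr EFin.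
rewrite powRM ?ltW// -/c.
have -> : (c `^ k = c `^ (k - 1) * c)%R.
  rewrite -[X in _ = (_ * X)%R](powRr1 (ltW c0)) -powRD ?(gt_eqF c0) ?implybT//.
  by congr (_ `^ _)%R; ring.
by field; rewrite gt_eqF ?Gamma_gt0.
Qed.

Lemma integral_gamma_pdf k r : (0 < k)%R -> (0 < r)%R ->
  \int[leb]_x (gamma_pdf k r x)%:E = 1.
Proof.
move=> k0 r0; have := laplace_gamma_pdf k0 r0 (lexx 0%R).
rewrite addr0 divff ?gt_eqF// powR1 => <-.
by apply: eq_integral => x _; rewrite mul0r oppr0 expR0 mul1r.
Qed.

(** As both rates are r, the exponentials combine to e^(-r z), free of t. What remains is a Beta
    integral, and [eGammaM] supplies its value. *)
Lemma gamma_pdf_conv p q r z : (0 < p)%R -> (0 < q)%R -> (0 < r)%R ->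
  \int[leb]_t (gamma_pdf p r t * gamma_pdf q r (z - t))%:E =
  (gamma_pdf (p + q) r z)%:E.
Proof.
move=> p0 q0 r0; have pq0 : (0 < p + q)%R by exact: addr_gt0.
have eB : eGamma p * eGamma q = eGamma (p + q) * eBeta p q by exact: eGammaM.
move: eB; rewrite (eGammaE p0) (eGammaE q0) (eGammaE pq0) -EFinM.
have := Gamma_gt0 p0; have := Gamma_gt0 q0; have := Gamma_gt0 pq0.
rewrite /gamma_pdf; move: (Gamma p) (Gamma q) (Gamma (p + q)) => Gp Gq G G0 Gq0 Gp0 eB.
pose c := (r `^ p / Gp * (r `^ q / Gq) * expR (- (r * z)))%R.
have c0 : 0 <= c%:E.
  rewrite lee_fin mulr_ge0 ?expR_ge0//.
  by apply: mulr_ge0; rewrite divr_ge0 ?powR_ge0 ?ltW.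
have mpq : measurable_fun setT (fun t : measurableTypeR R =>
    (trunc_pow p t * trunc_pow q (z - t))%:E).
  apply/measurable_EFinP; apply: measurable_funM; first exact: measurable_trunc_pow.
  apply: (measurableT_comp (measurable_trunc_pow q)).
  exact: measurable_funB.
transitivity (\int[leb]_t (c%:E * (trunc_pow p t * trunc_pow q (z - t))%:E)).
  apply: eq_integral => t _; rewrite -EFinM; congr EFin.
  have -> : c = (r `^ p / Gp * (r `^ q / Gq) *
      (expR (- (r * t)) * expR (- (r * (z - t)))))%R.
    by rewrite -expRD /c; congr (_ * expR _)%R; ring.
  by ring.
rewrite (ge0_integralZl _ measurableT mpq _ c0); last first.
  by move=> t _; rewrite lee_fin mulr_ge0 ?trunc_pow_ge0.
rewrite integral_trunc_powM muleCA (_ : c = G^-1 * (r `^ (p + q) * expR (- (r * z))) *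
    (G / (Gp * Gq)))%R; last first.
  rewrite powRD ?(gt_eqF r0) ?implybT// /c; field.
  by rewrite (gt_eqF G0) (gt_eqF Gp0) (gt_eqF Gq0).
have eBE : (G / (Gp * Gq))%:E * eBeta p q = 1.
  rewrite mulrC EFinM -muleA -eB -EFinM mulVf// mulf_neq0//.
  - exact: lt0r_neq0.
  - exact: lt0r_neq0.
rewrite EFinM -muleA eBE mule1 -EFinM; congr EFin; ring.
Qed.

End gamma_pdf.

(** * Laws given by densities, and their convolution *)

Section laws.
Context {R : realType}.
Local Notation leb := (@lebesgue_measure R).
Local Open Scope ereal_scope.
Implicit Types (P Q : real_law R) (f g : R -> R) (h : R -> \bar R).

Definition has_pdf f P := forall A : set R, measurable A ->
  P A = \int[leb]_(x in A) (f x)%:E.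

Lemma pdf_law f : measurable_fun setT f -> (forall x, 0 <= f x)%R ->
  \int[leb]_x (f x)%:E = 1 -> exists P, has_pdf f P.
Proof.
move=> mf f0 f1.
pose P (A : set (measurableTypeR R)) := \int[leb]_(x in A) (f x)%:E.
have P0 : P set0 = 0 by rewrite /P integral_set0.
have Pge0 A : 0 <= P A by apply: integral_ge0 => x _; rewrite lee_fin.
have Psigma : semi_sigma_additive P.
  move=> /= F mF tF mUF; rewrite /P; apply: cvg_toP.
    apply: ereal_nondecreasing_is_cvgn => m n mn.
    apply: lee_sum_nneg_natr => // i _ _; apply: integral_ge0 => /= x Fkx.
    by rewrite lee_fin.
  rewrite ge0_integral_bigcup//=.
  - by apply/measurable_funTS; exact: measurableT_comp.
  - by move=> x _; rewrite lee_fin.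
pose mP := isMeasure.Build _ _ _ P P0 Pge0 Psigma.
pose M : {measure set (measurableTypeR R) -> \bar R} := HB.pack P mP.
pose pP := Measure_isProbability.Build _ _ _ M f1.
pose Q : real_law R := HB.pack P mP pP.
by exists Q.
Qed.

Lemma integral_pdf f P h : has_pdf f P -> measurable_fun setT f ->
  (forall x, 0 <= f x)%R -> measurable_fun setT h -> (forall x, 0 <= h x) ->
  \int[P]_x h x = \int[leb]_x (h x * (f x)%:E).
Proof. by move=> Pf mf f0 mh h0; exact: ge0_integral_density. Qed.

Lemma gamma_law k r : (0 < k)%R -> (0 < r)%R ->
  exists P, has_pdf (gamma_pdf k r) P.
Proof.
move=> k0 r0; apply: pdf_law; last exact: integral_gamma_pdf.
- exact: measurable_gamma_pdf.
- by move=> x; exact: gamma_pdf_ge0.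
Qed.

Definition addRR (xy : measurableTypeR R * measurableTypeR R) : measurableTypeR R :=
  (xy.1 + xy.2)%R.

Lemma measurable_addRR : measurable_fun setT addRR.
Proof. by apply: measurable_funD. Qed.

HB.instance Definition _ := isMeasurableFun.Build _ _ _ _ _ measurable_addRR.

Definition conv P Q : real_law R := distribution (P \x Q) addRR.

Lemma integral_conv P Q h : measurable_fun setT h -> (forall x, 0 <= h x) ->
  \int[conv P Q]_z h z = \int[P]_x \int[Q]_y h (x + y)%R.
Proof.
move=> mh h0; rewrite /conv ge0_integral_distribution// fubini_tonelli1//.
  by apply: measurableT_comp => //; exact: measurable_addRR.
by move=> xy; exact: h0.
Qed.

(** Substitute y = z - x in the inner integral, then exchange. Stated for test functions h, it
    yields the density of [conv] from indicators and also serves [decomposable_gamma], where h is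
    arbitrary. *)
Lemma pdf_conv f g P Q h : has_pdf f P -> measurable_fun setT f ->
  (forall x, 0 <= f x)%R -> has_pdf g Q -> measurable_fun setT g ->
  (forall x, 0 <= g x)%R -> measurable_fun setT h -> (forall x, 0 <= h x) ->
  \int[P]_x \int[Q]_y h (x + y)%R =
  \int[leb]_z (h z * \int[leb]_t (f t * g (z - t))%:E).
Proof.
move=> Pf mf f0 Qg mg g0 mh h0.
transitivity (\int[P]_x \int[leb]_z (h z * (g (z - x))%:E)).
  apply: eq_integral => x _.
  rewrite (integral_pdf Qg)//; last exact: (measurableT_comp mh (measurable_funD _ _)).
  rewrite (ge0_integral_affine (- x)%R ltr01)//; last 2 first.
  - apply: emeasurable_funM; last exact: measurableT_comp.
    exact: (measurableT_comp mh (measurable_funD _ _)).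
  - by move=> y; rewrite mule_ge0// lee_fin.
  rewrite mul1e; apply: eq_integral => y _; rewrite mul1r.
  by congr (h _ * _); ring.
have m1 : measurable_fun setT
   (fun xz : measurableTypeR R * measurableTypeR R => h xz.2 * (g (xz.2 - xz.1))%:E).
  apply: emeasurable_funM; first exact: measurableT_comp.
  apply/measurable_EFinP; apply: (measurableT_comp mg); exact: measurable_funB.
rewrite (integral_pdf Pf)//; last 2 first.
- apply: (measurable_fun_fubini_tonelli_F _ m1) => xz.
  by rewrite mule_ge0// lee_fin.
- by move=> x; apply: integral_ge0 => z _; rewrite mule_ge0// lee_fin.
transitivity (\int[leb]_x \int[leb]_z (h z * (f x * g (z - x))%:E)).
  apply: eq_integral => x _; rewrite -ge0_integralZr//.
  - by apply: eq_integral => z _; rewrite EFinM -muleA [X in _ * X]muleC.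
  - exact: (measurableT_comp m1 (measurable_fun_pair _ _)).
  - by move=> z _; rewrite mule_ge0// lee_fin.
  - by rewrite lee_fin.
rewrite (fubini_tonelli
  (fun xz : measurableTypeR R * measurableTypeR R =>
    h xz.2 * (f xz.1 * g (xz.2 - xz.1))%:E))/=.
- apply: eq_integral => z _; rewrite ge0_integralZl//.
  + apply/measurable_EFinP; apply: measurable_funM => //.
    by apply: (measurableT_comp mg); exact: measurable_funB.
  + by move=> x _; rewrite lee_fin mulr_ge0.
- apply: emeasurable_funM; first exact: measurableT_comp.
  apply/measurable_EFinP; apply: measurable_funM; first exact: measurableT_comp.
  by apply: (measurableT_comp mg); exact: measurable_funB.
- by move=> xz; rewrite mule_ge0// lee_fin mulr_ge0.
Qed.

End laws.

(** * Laplace transforms, infinite divisibility and the generalized gamma form *)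

Section nonneg_laws.
Context {R : realType}.
Local Notation leb := (@lebesgue_measure R).
Local Open Scope ereal_scope.
Implicit Types (P Q : real_law R) (s k r : R).

Lemma measurable_expRM s : measurable_fun setT (fun t => (expR (- (s * t)))%R).
Proof.
apply: (measurableT_comp (@measurable_expR R)).
by apply: measurableT_comp => //; exact: measurable_funM.
Qed.

Lemma nonneg_law_gamma k r P : (0 < k)%R -> (0 < r)%R ->
  has_pdf (gamma_pdf k r) P -> nonneg_law P.
Proof.
move=> k0 r0 Pg; rewrite /nonneg_law Pg; last exact: measurable_itv.
rewrite integral_mkcond -(integral_gamma_pdf k0 r0).
apply: eq_integral => x _; rewrite patchE; case: ifPn => //.
rewrite notin_setE/= in_itv/= andbT => /negP; rewrite -ltNge => x0.
by rewrite gamma_pdf_le0// ltW.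
Qed.

Lemma nonneg_law_conv P Q : nonneg_law P -> nonneg_law Q -> nonneg_law (conv P Q).
Proof.
move=> P0 Q0; apply/eqP; rewrite eq_le probability_le1/=; last exact: measurable_itv.
have <- : (P \x Q) (`[0%R, +oo[ `*` `[0%R, +oo[) = 1.
  rewrite product_measure1E; [|exact: measurable_itv..].
  by rewrite -[RHS]mule1; congr (_ * _); [exact: P0|exact: Q0].
rewrite /conv /distribution /pushforward; apply: le_measure.
- by rewrite inE; apply: measurableX; exact: measurable_itv.
- by rewrite inE -[X in measurable X]setTI; exact: measurable_addRR.
- move=> [x y]; rewrite /= !in_itv/= !andbT => -[x0 y0].
  exact: addr_ge0.
Qed.

Lemma laplace_integralT P s : nonneg_law P ->
  laplace P s = \int[P]_t (expR (- (s * t)))%:E.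
Proof.
move=> P0; rewrite /laplace.
rewrite [RHS](@ge0_negligible_integral _ _ _ _ _ 
  (~` (`[0%R, +oo[%classic : set (measurableTypeR R))))//.
- by rewrite setTD setCK.
- by apply: measurableC; exact: measurable_itv.
- by apply/measurable_EFinP; exact: measurable_expRM.
- transitivity (1 - P `[0%R, +oo[%classic).
    by apply: probability_setC; exact: measurable_itv.
  by have -> : P `[0%R, +oo[%classic = 1; [exact: P0|rewrite subee].
Qed.

Lemma laplace_conv P Q s : nonneg_law P -> nonneg_law Q ->
  laplace (conv P Q) s = laplace P s * laplace Q s.
Proof.
move=> P0 Q0; rewrite !laplace_integralT//; last exact: nonneg_law_conv.
have me : measurable_fun setT (fun t => (expR (- (s * t)))%:E).
  by apply/measurable_EFinP; exact: measurable_expRM.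
rewrite integral_conv// -ge0_integralZr//.
  apply: eq_integral => x _; rewrite -ge0_integralZl//.
  by apply: eq_integral => y _; rewrite mulrDr opprD expRD EFinM.
by apply: integral_ge0 => y _; rewrite lee_fin expR_ge0.
Qed.

Lemma laplace_gamma k r P s : (0 < k)%R -> (0 < r)%R -> (0 <= s)%R ->
  has_pdf (gamma_pdf k r) P -> laplace P s = ((r / (r + s)) `^ k)%:E.
Proof.
move=> k0 r0 s0 Pg; rewrite laplace_integralT; last exact: nonneg_law_gamma Pg.
rewrite (integral_pdf Pg).
- by rewrite -laplace_gamma_pdf//; apply: eq_integral => x _; rewrite EFinM.
- exact: measurable_gamma_pdf.
- by move=> x; exact: gamma_pdf_ge0.
- by apply/measurable_EFinP; exact: measurable_expRM.
- by move=> x; rewrite lee_fin expR_ge0.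
Qed.

(** Dividing the shape k by n extracts the n-th root of both transforms. *)
Lemma infinitely_divisible_gamma2 k r1 r2 P Q : (0 < k)%R -> (0 < r1)%R -> (0 < r2)%R ->
  has_pdf (gamma_pdf k r1) P -> has_pdf (gamma_pdf k r2) Q ->
  infinitely_divisible (conv P Q).
Proof.
move=> k0 r10 r20 Pg Qg; have P0 := nonneg_law_gamma k0 r10 Pg.
have Q0 := nonneg_law_gamma k0 r20 Qg.
split=> [|n n0]; first exact: nonneg_law_conv.
have kn0 : (0 < k / n%:R)%R by rewrite divr_gt0// ltr0n.
have [Pn Png] := gamma_law kn0 r10; have [Qn Qng] := gamma_law kn0 r20.
have Pn0 := nonneg_law_gamma kn0 r10 Png; have Qn0 := nonneg_law_gamma kn0 r20 Qng.
exists (conv Pn Qn) => [|s /ltW s0]; first exact: nonneg_law_conv.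
rewrite !laplace_conv// (laplace_gamma k0 r10 s0 Pg) (laplace_gamma k0 r20 s0 Qg).
rewrite (laplace_gamma kn0 r10 s0 Png) (laplace_gamma kn0 r20 s0 Qng).
rewrite -!EFinM -EFin_expe exprMn; congr (_ * _)%:E.
all: rewrite -powR_mulrn ?powR_ge0// -powRrM divfK//.
all: by rewrite pnatr_eq0 -lt0n.
Qed.

Lemma ggc_gamma2 k r1 r2 P Q : (0 < k)%R -> (0 < r1)%R -> (0 < r2)%R ->
  has_pdf (gamma_pdf k r1) P -> has_pdf (gamma_pdf k r2) Q ->
  generalized_gamma_convolution (conv P Q).
Proof.
move=> k0 r10 r20 Pg Qg; have P0 := nonneg_law_gamma k0 r10 Pg.
have Q0 := nonneg_law_gamma k0 r20 Qg.
split; first exact: nonneg_law_conv.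
(* No drift, and mass k at each of the two rates: k ln(r / (s + r)) is the logarithm of (r / (r +
   s))^k. *)
exists 0%R => //.
exists (mscale (NngNum (ltW k0)) (measure_add (\d_(r1 : measurableTypeR R))
  (\d_(r2 : measurableTypeR R)))) => s s0.
rewrite laplace_conv// (laplace_gamma k0 r10 s0 Pg) (laplace_gamma k0 r20 s0 Qg).
set m := mscale _ _.
have mD : measurable (`]0%R, +oo[%classic : set (measurableTypeR R)).
  exact: measurable_itv.
have ml : measurable_fun (`]0%R, +oo[%classic : set (measurableTypeR R))
    (fun t => (ln (t / (s + t)))%:E).
  apply/measurable_EFinP.
  apply: (eq_measurable_fun (fun t => ln t - ln (s + t))%R).
    move=> t; rewrite inE/= in_itv/= andbT => t0.
    by rewrite ln_div// posrE ltr_wpDl.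
  apply: measurable_funTS; apply: measurable_funB; first exact: measurable_ln.
  apply: (measurableT_comp (@measurable_ln R)).
  exact: measurable_funD.
have l0 (t : R) : `]0%R, +oo[%classic t -> 0 <= - (ln (t / (s + t)))%:E.
  rewrite /= in_itv/= andbT => t0; rewrite lee_fin oppr_ge0 ln_le0//.
  by rewrite ler_pdivrMr ?mul1r ?lerDr// ltr_wpDl.
(* The integrand is nonpositive, so the rules for scaled and added measures, which concern
   nonnegative functions, are applied to its opposite. *)
have -> : \int[m]_(t in `]0%R, +oo[) (ln (t / (s + t)))%:E =
    - \int[m]_(t in `]0%R, +oo[) (- (ln (t / (s + t)))%:E).
  by rewrite -integral_ge0N//; apply: eq_integral => t _; rewrite oppeK.
rewrite /m ge0_integral_mscale//; last exact: measurableT_comp.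
rewrite ge0_integral_measure_add//; last exact: measurableT_comp.
have d1 r : (0 < r)%R ->
    \int[\d_(r : measurableTypeR R)]_(t in `]0%R, +oo[) (- (ln (t / (s + t)))%:E) =
    (- ln (r / (s + r)))%:E.
  move=> r0; rewrite integral_dirac//; last exact: measurableT_comp.
  by rewrite diracE mem_set ?mul1e//= in_itv/= andbT.
rewrite !d1// mul0r oppr0 add0e -EFinD -!EFinM /=; congr EFin.
rewrite /powR !gt_eqF ?divr_gt0 ?ltr_wpDr// !(addrC s) -expRD.
by congr expR; ring.
Qed.

End nonneg_laws.

(** * Self-decomposability *)

Section self_decomposability.
Context {R : realType}.
Local Notation leb := (@lebesgue_measure R).
Local Notation mR := (measurableTypeR R).
Local Open Scope ereal_scope.
Implicit Types (P Q : real_law R) (c k r : R) (h : R -> \bar R).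

(** H is the law of Xc. The iterated integral encodes independence, and equality in law is tested on
    nonnegative measurable functions, so no random variables appear. *)
Definition decomposable c P := exists H : real_law R, forall h,
  measurable_fun setT h -> (forall x, 0 <= h x) ->
  \int[P]_z h z = \int[P]_x \int[H]_y h (y + c * x)%R.

(** The coordinates of the product of P and H serve as X and Xc; indicators as test functions give
    the equality in law. *)
Lemma self_decomposableP P :
  (forall c, (0 < c < 1)%R -> decomposable c P) -> self_decomposable P.
Proof.
move=> dP c c01; have [H PH] := dP c c01.
pose X : {RV (P \x H) >-> R} := HB.pack (fst : mR * mR -> R)
  (isMeasurableFun.Build _ _ _ _ (fst : mR * mR -> R) measurable_fst).
pose Y : {RV (P \x H) >-> R} := HB.pack (snd : mR * mR -> R)
  (isMeasurableFun.Build _ _ _ _ (snd : mR * mR -> R) measurable_snd).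
have HT : H setT = 1 := probability_setT H.
have PT : P setT = 1 := probability_setT P.
have XY A B : measurable A -> measurable B ->
    (P \x H) (X @^-1` A `&` Y @^-1` B) = P A * H B.
  move=> mA mB; transitivity ((P \x H) (A `*` B)); last exact: product_measure1E.
  by congr (_ _); apply/seteqP; split => [[x y] []|[x y] []].
have PX A : measurable A -> (P \x H) (X @^-1` A) = P A.
  by move=> mA; rewrite -[RHS]mule1 -HT -XY// preimage_setT setIT.
have HY B : measurable B -> (P \x H) (Y @^-1` B) = H B.
  by move=> mB; rewrite -[RHS]mul1e -PT -XY// preimage_setT setTI.
exists _, (mR * mR)%type, (P \x H), X, Y; split; first exact: PX.
- move=> A B mA mB; transitivity (P A * H B); first exact: XY.
  by congr (_ * _); apply/esym; [exact: PX|exact: HY].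
- move=> A mA.
  have mS : measurable_fun setT (fun w : mR * mR => (w.2 + c * w.1)%R).
    apply: measurable_funD => //; exact: measurable_funM.
  have mT : measurable [set w : mR * mR | A (w.2 + c * w.1)%R].
    by rewrite -[X in measurable X]setTI; exact: mS.
  have mI : measurable_fun setT (fun x : R => (\1_A x : R)%:E).
    by apply/measurable_EFinP; exact: measurable_indic.
  have PA : P A = \int[P]_x (\1_A x : R)%:E by rewrite integral_indic// setIT.
  rewrite PA PH//.
  set S := (S in measurable S) in mT.
  transitivity (\int[P \x H]_w (\1_S w : R)%:E); first by rewrite integral_indic// setIT.
  rewrite fubini_tonelli1//.
  by apply/measurable_EFinP; exact: measurable_indic.
Qed.

(** The sum (Xc + c X) + (Yc + c Y) is regrouped as (Xc + Yc) + c (X + Y), so the convolution of the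
    two remainders works. *)
Lemma decomposable_conv c P Q :
  decomposable c P -> decomposable c Q -> decomposable c (conv P Q).
Proof.
move=> [H PH] [K QK]; exists (conv H K) => h mh h0.
have mhD d (T : measurableType d) (f : T -> R) : measurable_fun setT f ->
    measurable_fun setT (h \o f) by exact: measurableT_comp.
pose g u := \int[Q]_x \int[K]_y h (u + (y + c * x))%R.
have g0 u : 0 <= g u by do 2 (apply: integral_ge0 => ? _).
have gE u : \int[Q]_v h (u + v)%R = g u.
  rewrite (QK (fun v => h (u + v)%R))//.
  by apply: (mhD _ _ (fun v => u + v)%R); exact: measurable_funD.
have mg : measurable_fun setT g.
  rewrite -(funext gE).
  apply: (measurable_fun_fubini_tonelli_F (fun w : mR * mR => h (w.1 + w.2)%R)) => //.
  by apply: (mhD _ _ (fun w : mR * mR => w.1 + w.2)%R); exact: measurable_funD.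
rewrite integral_conv//.
under eq_integral do rewrite gE.
rewrite PH// integral_conv; last 2 first.
- apply: (measurable_fun_fubini_tonelli_F (fun w : mR * mR => h (w.2 + c * w.1)%R)) => //.
  apply: (mhD _ _ (fun w : mR * mR => w.2 + c * w.1)%R).
  by apply: measurable_funD => //; exact: measurable_funM.
- by move=> x; apply: integral_ge0 => ? _.
apply: eq_integral => x _.
(* The regrouping itself: the integral over Q moves outside the one over H. *)
rewrite /g (fubini_tonelli
  (fun w : mR * mR => \int[K]_y h (w.1 + c * x + (y + c * w.2))%R))/=; last 2 first.
- apply: (measurable_fun_fubini_tonelli_F
    (fun w : mR * mR * mR => h (w.1.1 + c * x + (w.2 + c * w.1.2))%R)) => //.
  apply: (mhD _ _ (fun w : mR * mR * mR => w.1.1 + c * x + (w.2 + c * w.1.2))%R).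
  have m11 : measurable_fun setT (fun w : mR * mR * mR => w.1.1).
    by apply: measurableT_comp => //; exact: measurable_fst.
  have m12 : measurable_fun setT (fun w : mR * mR * mR => w.1.2).
    by apply: measurableT_comp => //; exact: measurable_snd.
  apply: measurable_funD; first exact: measurable_funD.
  by apply: measurable_funD => //; exact: measurable_funM.
- by move=> w; apply: integral_ge0 => ? _.
apply: eq_integral => x' _.
have mhx : measurable_fun setT (fun y : mR => h (y + c * (x + x'))%R).
  by apply: (measurableT_comp mh); exact: measurable_funD.
rewrite (integral_conv H K mhx (fun=> h0 _)).
apply: eq_integral => y _; apply: eq_integral => y' _.
by congr h; ring.
Qed.

End self_decomposability.

(** * Gamma laws as negative binomial mixtures *)

Section gamma_self_decomposability.
Context {R : realType}.
Local Notation leb := (@lebesgue_measure R).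
Local Notation mR := (measurableTypeR R).
Implicit Types (P Q : real_law R) (c k r : R) (h : R -> \bar R).

(** The Gamma quotient is the binomial coefficient of n + k - 1 over n, for a real shape k; c is the
    success probability. *)
Definition negbin_pmf k c (n : nat) : R :=
  c `^ k * (1 - c) ^+ n * Gamma (n%:R + k) / (Gamma k * n`!%:R).

Lemma negbin_pmf_ge0 k c n : 0 < k -> 0 < c < 1 -> 0 <= negbin_pmf k c n.
Proof.
move=> k0 /andP[c0 c1]; have nk0 : 0 < n%:R + k by rewrite ltr_wpDl.
rewrite divr_ge0// !mulr_ge0 ?powR_ge0 ?exprn_ge0 ?subr_ge0 ?(ltW (Gamma_gt0 _))//.
exact: ltW.
Qed.

(** The two values of Gamma at n + k cancel, and r/c = r + (1 - c)(r/c) splits the exponential. The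
    index n survives only in a Poisson weight of mean (1 - c)(r/c) x. *)
Lemma negbin_pmf_gamma_pdf k c r n x : 0 < k -> 0 < c -> 0 < r -> 0 < x ->
  negbin_pmf k c n * gamma_pdf (n%:R + k) (r / c) x =
  gamma_pdf k r x * expR (- ((1 - c) * (r / c) * x)) *
    (((1 - c) * (r / c) * x) ^+ n / n`!%:R).
Proof.
move=> k0 c0 r0 x0; have rc0 : 0 < r / c by rewrite divr_gt0.
have nk0 : 0 < n%:R + k by rewrite ltr_wpDl.
rewrite /negbin_pmf /gamma_pdf !(trunc_pow_gt0 _ x0).
have -> : (r / c) `^ (n%:R + k) = (r / c) ^+ n * (r `^ k / c `^ k).
  rewrite powRD ?(gt_eqF rc0) ?implybT// powR_mulrn ?(ltW rc0)//.
  have cV : c^-1 `^ k = (c `^ k)^-1 by rewrite -powR_inv1 ?ltW// -powRrM mulN1r powRN.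
  by rewrite powRM ?invr_ge0 ?(ltW r0) ?(ltW c0)// cV.
have -> : x `^ (n%:R + k - 1) = x ^+ n * x `^ (k - 1).
  by rewrite -addrA [LHS]powRD ?(gt_eqF x0) ?implybT// powR_mulrn// ltW.
have -> : expR (- (r / c * x)) = expR (- (r * x)) * expR (- ((1 - c) * (r / c) * x)).
  by rewrite -expRD; congr expR; field; rewrite gt_eqF.
rewrite !exprMn; have f0 : 0 < n`!%:R :> R by rewrite ltr0n fact_gt0.
have := Gamma_gt0 nk0; have := Gamma_gt0 k0; have := powR_gt0 k c0; move: f0.
move: (Gamma (_ + _)) (Gamma k) (c `^ k) (n`!%:R) => G Gk ck f f0 ck0 Gk0 G0.
by field; rewrite (gt_eqF f0) (gt_eqF ck0) (gt_eqF Gk0) (gt_eqF G0).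
Qed.

Local Open Scope ereal_scope.

(** The factor u may be infinite, as h z may be in [decomposable_gamma]. *)
Lemma ge0_nneseriesZl (u : \bar R) (a : nat -> \bar R) : 0 <= u ->
  (forall n, 0 <= a n) -> \sum_(n <oo) (u * a n) = u * \sum_(n <oo) a n.
Proof.
move=> u0 a0; rewrite -!ge0_integral_count//; last by move=> n; exact: mule_ge0.
by rewrite ge0_integralZl.
Qed.

Lemma expR_nneseries (x : R) : (0 <= x)%R ->
  \sum_(n <oo) (x ^+ n / n`!%:R)%:E = (expR x)%:E.
Proof.
move=> x0; apply/cvg_lim => //.
rewrite (_ : (fun n => _) = EFin \o series (exp_coeff x)); last first.
  by apply/funext => n; rewrite /series/= -sumEFin.
by apply: cvg_EFin; [exact: nearW|exact: is_cvg_series_exp_coeff].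
Qed.

Lemma integral_gamma_scale k r c P h : (0 < k)%R -> (0 < r)%R -> (0 < c)%R ->
  has_pdf (gamma_pdf k r) P -> measurable_fun setT h -> (forall x, 0 <= h x) ->
  \int[P]_x h (c * x)%R = \int[leb]_x (h x * (gamma_pdf k (r / c) x)%:E).
Proof.
move=> k0 r0 c0 Pg mh h0; have c'0 : (0 < c^-1)%R by rewrite invr_gt0.
have mg := @measurable_gamma_pdf R; have g0 := fun r x => gamma_pdf_ge0 r x k0.
have mhc : measurable_fun setT (fun x => h (c * x)%R).
  by apply: (measurableT_comp mh); exact: measurable_funM.
have mi q : measurable_fun setT (fun x => h x * (gamma_pdf k q x)%:E).
  by apply: emeasurable_funM => //; apply/measurable_EFinP; exact: mg.
rewrite (integral_pdf Pg (mg k r) (g0 r) mhc (fun=> h0 _)).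
rewrite (ge0_integral_affine 0 c'0); last 2 first.
- by apply: emeasurable_funM => //; apply/measurable_EFinP; exact: mg.
- by move=> x; rewrite mule_ge0// lee_fin.
rewrite -ge0_integralZl//; last 3 first.
- apply: (@measurableT_comp _ _ _ _ _ _ (fun x => h (c * x)%R * (gamma_pdf k r x)%:E)).
    by apply: emeasurable_funM => //; apply/measurable_EFinP; exact: mg.
  by apply: measurable_funD => //; exact: measurable_funM.
- by move=> x _; rewrite mule_ge0// lee_fin.
- by rewrite lee_fin ltW.
apply: eq_integral => x _; rewrite addr0 mulrA divff ?gt_eqF// mul1r.
by rewrite muleCA -EFinM gamma_pdfZ.
Qed.

(* X ~ Gamma(k, r) and [c X + G_N] are equal in law, where [N] is negative
   binomial and [G_n] ~ Gamma(n, r / c), [G_0 = 0]. *)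
Lemma decomposable_gamma c k r P : (0 < c < 1)%R -> (0 < k)%R -> (0 < r)%R ->
  has_pdf (gamma_pdf k r) P -> decomposable c P.
Proof.
move=> /andP[c0 c1] k0 r0 Pg; have rc0 : (0 < r / c)%R by rewrite divr_gt0.
have G0 (n : nat) : (0 < Gamma (n%:R + k))%R.
  by apply: Gamma_gt0; rewrite ltr_wpDl.
have /choice[D HD] : forall n : nat, exists Dn : real_law R,
    forall h, measurable_fun setT h -> (forall x, 0 <= h x) ->
    \int[P]_x \int[Dn]_y h (y + c * x)%R =
    \int[leb]_z (h z * (gamma_pdf (n%:R + k) (r / c) z)%:E).
  case=> [|n].
  (* Shape 0 has no density, hence a Dirac mass; only c X ~ Gamma(k, r/c) remains. *)
  - exists (\d_(0%R : mR) : real_law R) => h mh h0.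
    rewrite add0r -(integral_gamma_scale k0 r0 c0 Pg)//.
    apply: eq_integral => x _; rewrite integral_dirac//; last first.
      by apply: (measurableT_comp mh); exact: measurable_funD.
    by rewrite diracE mem_set// mul1e add0r.
  have n0 : (0 < n.+1%:R :> R)%R by [].
  have [Dn Dng] := gamma_law n0 rc0.
  have [Q Qg] := gamma_law k0 rc0.
  exists Dn => h mh h0.
  (* Q is the law of c X. It has the same rate r/c as [Dn], so the shapes add up. *)
  transitivity (\int[Q]_x \int[Dn]_y h (x + y)%R).
    pose H x := \int[Dn]_y h (x + y)%R.
    have mH : measurable_fun setT H.
      apply: (measurable_fun_fubini_tonelli_F (fun w : mR * mR => h (w.1 + w.2)%R)) => //.
      by apply: (measurableT_comp mh); exact: measurable_funD.
    have H0 x : 0 <= H x by apply: integral_ge0.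
    rewrite (integral_pdf Qg (measurable_gamma_pdf k _)
      (fun x => gamma_pdf_ge0 _ x k0) mH H0).
    rewrite -(integral_gamma_scale k0 r0 c0 Pg mH H0).
    by apply: eq_integral => x _; apply: eq_integral => y _; rewrite addrC.
  rewrite (pdf_conv Qg _ _ Dng)//.
  - by apply: eq_integral => z _; rewrite gamma_pdf_conv// addrC.
  - exact: measurable_gamma_pdf.
  - by move=> x; exact: gamma_pdf_ge0.
  - exact: measurable_gamma_pdf.
  - by move=> x; exact: gamma_pdf_ge0.
pose w n := negbin_pmf k c n.
have w0 n : (0 <= w n)%R by rewrite negbin_pmf_ge0 ?c0.
(* The comparison of densities: for z > 0 the Poisson weights sum to 1, and for z <= 0 all terms
   vanish. *)
have wE z : \sum_(n <oo) (w n * gamma_pdf (n%:R + k) (r / c) z)%:E = (gamma_pdf k r z)%:E.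
  have [z0|z0] := leP z 0%R.
    by rewrite gamma_pdf_le0// eseries0// => n _ _; rewrite gamma_pdf_le0// mulr0.
  have x0 : (0 <= (1 - c) * (r / c) * z)%R.
    by rewrite mulr_ge0 ?(ltW z0)// mulr_ge0 ?(ltW rc0)// subr_ge0 ltW.
  transitivity (\sum_(n <oo) ((gamma_pdf k r z * expR (- ((1 - c) * (r / c) * z)))%:E *
      (((1 - c) * (r / c) * z) ^+ n / n`!%:R)%:E)).
    apply: eq_eseriesr => n _; rewrite -EFinM; congr EFin.
    exact: negbin_pmf_gamma_pdf.
  rewrite nneseriesZl; last first.
    by move=> n _; rewrite lee_fin divr_ge0// exprn_ge0.
  rewrite expR_nneseries// -EFinM; set y := ((1 - c) * _ * z)%R.
  by rewrite -mulrA -expRD addNr expR0 mulr1.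
pose M := mseries (fun n => mscale (NngNum (w0 n)) (D n)) 0.
have ME h : measurable_fun setT h -> (forall x, 0 <= h x) ->
    \int[P]_x \int[M]_y h (y + c * x)%R = \int[P]_x h x.
  move=> mh h0.
  have mhx x : measurable_fun setT (fun y : mR => h (y + c * x)%R).
    by apply: (measurableT_comp mh); exact: measurable_funD.
  transitivity (\int[P]_x \sum_(n <oo) ((w n)%:E * \int[D n]_y h (y + c * x)%R)).
    apply: eq_integral => x _; rewrite ge0_integral_measure_series//.
    by apply: eq_eseriesr => n _; rewrite ge0_integral_mscale.
  have mD n : measurable_fun setT (fun x : mR => \int[D n]_y h (y + c * x)%R).
    apply: (measurable_fun_fubini_tonelli_F
      (fun w : mR * mR => h (w.2 + c * w.1)%R)) => //.
    apply: (measurableT_comp mh).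
    by apply: measurable_funD => //; exact: measurable_funM.
  have D0 n x : 0 <= \int[D n]_y h (y + c * x)%R by apply: integral_ge0.
  rewrite integral_nneseries//; last 2 first.
  - by move=> n; apply: emeasurable_funM.
  - by move=> n x _; rewrite mule_ge0// lee_fin.
  have mhg n : measurable_fun setT
      (fun z : mR => h z * (gamma_pdf (n%:R + k) (r / c) z)%:E).
    by apply: emeasurable_funM => //; apply/measurable_EFinP; exact: measurable_gamma_pdf.
  have hg0 (n : nat) z : 0 <= h z * (gamma_pdf (n%:R + k) (r / c) z)%:E.
    by rewrite mule_ge0// lee_fin gamma_pdf_ge0// ltr_wpDl.
  transitivity (\sum_(n <oo) \int[leb]_z
      ((w n)%:E * (h z * (gamma_pdf (n%:R + k) (r / c) z)%:E))).
    apply: eq_eseriesr => n _; rewrite ge0_integralZl//; last by rewrite lee_fin.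
    by rewrite HD// ge0_integralZl// lee_fin.
  rewrite -integral_nneseries//; last 2 first.
  - by move=> n; apply: emeasurable_funM.
  - by move=> n z _; rewrite mule_ge0// lee_fin.
  rewrite (integral_pdf Pg)//; last 2 first.
  - exact: measurable_gamma_pdf.
  - by move=> x; exact: gamma_pdf_ge0.
  apply: eq_integral => z _.
  under eq_eseriesr do rewrite muleCA -EFinM.
  rewrite ge0_nneseriesZl ?wE// => n.
  by rewrite lee_fin mulr_ge0// gamma_pdf_ge0// ltr_wpDl.
(* Taking h = 1 in [ME] gives the total mass without summing the negative binomial weights. *)
have M1 : M setT = 1.
  have P1 (u : \bar R) : \int[P]_x (fun=> u) x = u.
    rewrite integral_cst//= (_ : P _ = 1) ?mule1//; exact: probability_setT.
  transitivity (\int[P]_x \int[M]_y cst 1 (y + c * x)%R); last first.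
    by rewrite ME//; exact: P1.
  by rewrite -[LHS]P1; apply: eq_integral => x _; rewrite integral_cst// mul1e.
pose pM := Measure_isProbability.Build _ _ _ M M1.
pose H : real_law R := HB.pack M pM.
by exists H => h mh h0; rewrite -ME.
Qed.

End gamma_self_decomposability.

(** * Poisson's integral and the McKay density *)

Section bessel.
Context {R : realType}.
Local Notation leb := (@lebesgue_measure R).
Implicit Types k mu a b x y z w : R.

(** The factors 1 + w and 1 - w have sum 2, so they are never both negative and the product cannot
    be positive outside ]-1, 1[. *)
Lemma trunc_pow_1DB k w :
  trunc_pow k (1 + w) * trunc_pow k (1 - w) = trunc_pow k (1 - w ^+ 2).
Proof.
have E : 1 - w ^+ 2 = (1 + w) * (1 - w) by ring.
have [w1|w1] := ltP 0 (1 + w); last first.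
  rewrite trunc_pow_le0// mul0r trunc_pow_le0// E.
  by rewrite mulr_le0_ge0//; lra.
have [w2|w2] := ltP 0 (1 - w); last first.
  rewrite [X in _ * X]trunc_pow_le0// mulr0 trunc_pow_le0// E.
  by rewrite mulr_ge0_le0// ltW.
by rewrite E !trunc_pow_gt0 ?mulr_gt0// powRM ?ltW.
Qed.

Local Open Scope ereal_scope.

(** Links the extended-real sums of termwise integration to [besselI], a limit of real partial
    sums. *)
Lemma nneseries_limn_series (u : R^nat) (l : R) :
  \sum_(n <oo) (u n)%:E = l%:E -> (forall n, 0 <= u n)%R -> limn (series u) = l.
Proof.
move=> ul u0; apply/cvg_lim => //.
have -> : series u = fine \o (fun n => \sum_(0 <= i < n) (u i)%:E).
  by apply/funext => n; rewrite /= sumEFin.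
apply: fine_cvg; rewrite -ul.
by apply: is_cvg_nneseries => n _ _; rewrite lee_fin.
Qed.

(** The first n terms are the average of the first 2n terms for e^x and e^(-x), the odd powers
    cancelling. *)
Lemma cosh_nneseries x :
  \sum_(n <oo) (x ^+ n.*2 / n.*2`!%:R)%:E = ((expR x + expR (- x)) / 2)%:E.
Proof.
apply/cvg_lim => //.
have -> : (fun n => \sum_(0 <= i < n) (x ^+ i.*2 / i.*2`!%:R)%:E) =
    (fun n => ((series (exp_coeff x) n.*2 + series (exp_coeff (- x)) n.*2) / 2)%:E).
  apply/funext => n; rewrite sumEFin; congr EFin.
  have ee m : exp_coeff (- x) m.*2 = exp_coeff x m.*2.
    by rewrite !exp_coeffE exprNn -signr_odd odd_double expr0 mul1r.
  have eo m : exp_coeff (- x) m.*2.+1 = (- exp_coeff x m.*2.+1)%R.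
    by rewrite !exp_coeffE exprNn -signr_odd oddS odd_double expr1 mulN1r mulrN.
  elim: n => [|n IHn].
    by rewrite big_nil /series/= !big_nil addr0 mul0r.
  rewrite big_nat_recr//= IHn doubleS !seriesSr ee eo.
  by rewrite (_ : (x ^+ n.*2 / n.*2`!%:R)%R = exp_coeff x n.*2)//; field.
apply: cvg_EFin; first exact: nearW.
change (((series (exp_coeff x) n.*2 + series (exp_coeff (- x)) n.*2) / 2)%R
    @[n --> \oo] -->
  ((expR x + expR (- x)) / 2)%R).
have d2 : (fun n => n.*2) @ \oo --> \oo.
  by apply/cvgnyPge => m; exists m => // n /= mn; rewrite -addnn (leq_trans mn) ?leq_addr.
by apply: cvgM; [apply: cvgD|exact: cvg_cst];
  apply: (cvg_comp _ _ d2); exact: is_cvg_series_exp_coeff.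
Qed.

(** The expansion of e^(y w) has terms of both signs. Adding the integral to its image under w -> -w
    produces 2 cosh(y w), whose series has nonnegative terms and may be integrated termwise. *)
Lemma integral_expR_sphere k y : (0 < k)%R -> (0 < y)%R ->
  \int[leb]_w (trunc_pow k (1 - w ^+ 2) * expR (y * w))%:E =
  (Num.sqrt pi * Gamma k * (y / 2) `^ (2^-1 - k) * besselI (k - 2^-1) y)%:E.
Proof.
move=> k0 y0.
pose f w := (trunc_pow k (1 - w ^+ 2))%R.
have mf : measurable_fun setT f by exact: measurable_trunc_pow_sqr.
have f0 w : (0 <= f w)%R by exact: trunc_pow_ge0.
have me (s : R) : measurable_fun setT (fun w => expR (s * w))%R.
  by apply: (measurableT_comp (@measurable_expR R)); exact: measurable_funM.
have mfe (s : R) : measurable_fun setT (fun w => (f w * expR (s * w))%:E).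
  by apply/measurable_EFinP; exact: measurable_funM.
have fe0 s w : 0 <= (f w * expR (s * w))%:E by rewrite lee_fin mulr_ge0 ?expR_ge0.
pose K := \int[leb]_w (f w * expR (y * w))%:E; rewrite -/K.
have KN : K = \int[leb]_w (f w * expR (- y * w))%:E.
  rewrite [LHS](ge0_integral_opp (mfe y) (fe0 y)).
  by apply: eq_integral => w _; rewrite /f sqrrN mulrN mulNr.
have K2 : K + K =
    \int[leb]_w ((2 * f w)%:E * \sum_(n <oo) ((y * w) ^+ n.*2 / n.*2`!%:R)%:E).
  rewrite {2}KN /K -ge0_integralD//; last 2 first.
  - exact: mfe.
  - exact: mfe.
  apply: eq_integral => w _; rewrite cosh_nneseries -EFinD -EFinM mulNr; congr EFin.
  by rewrite /f; field.
(* On the support |w| < 1 the exponential is at most e^y. Finiteness allows halving K + K and later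
   yields the convergence of the Bessel series. *)
have Kfin : K \is a fin_num.
  rewrite ge0_fin_numE; last by apply: integral_ge0 => w _; exact: fe0.
  apply: (@le_lt_trans _ _ ((expR y)%:E * sphere_moment 0 k)); last first.
    by rewrite sphere_momentE// -EFinM ltry.
  have mf1 : measurable_fun setT (fun w => (f w * w ^+ 0.*2)%:E).
    by apply/measurable_EFinP; exact: measurable_funM.
  rewrite /sphere_moment -ge0_integralZl//; last first.
    by move=> w _; rewrite lee_fin mulr_ge0// f0.
  apply: ge0_le_integral => //.
  - exact: mfe.
  - by apply: emeasurable_funM => //; exact: mf1.
  move=> w _; rewrite -EFinM lee_fin mulr1 mulrC /f /trunc_pow.
  case: ifPn => [w1|_]; last by rewrite !mulr0.
  rewrite ler_wpM2r ?powR_ge0// ler_expR ler_piMr ?(ltW y0)//.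
  by nra.
clearbody K.
pose c := (Num.sqrt pi * Gamma k * (y / 2) `^ (2^-1 - k))%R.
pose u (n : nat) := ((y / 2) `^ (n.*2%:R + (k - 2^-1)) /
  (n`!%:R * Gamma (n%:R + (k - 2^-1) + 1)))%R.
have nk0 (n : nat) : (0 < n%:R + (k - 2^-1) + 1)%R by have := ler0n R n; lra.
have u0 n : (0 <= u n)%R.
  by rewrite divr_ge0 ?powR_ge0// mulr_ge0// ltW// Gamma_gt0.
have y20 : (0 < y / 2)%R by rewrite divr_gt0.
have c0 : (0 < c)%R.
  by rewrite !mulr_gt0 ?powR_gt0 ?Gamma_gt0 ?sqrtr_gt0 ?pi_gt0.
have term n w : (2 * f w * ((y * w) ^+ n.*2 / n.*2`!%:R) =
    2 * y ^+ n.*2 / n.*2`!%:R * (f w * w ^+ n.*2))%R.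
  by rewrite exprMn; ring.
(* The (2n)! of the cosh series cancels that of the moment, whose 4^n turns y^(2n) into
   (y/2)^(2n). *)
have cu n : (2 * y ^+ n.*2 / n.*2`!%:R)%:E * sphere_moment n k = (2 * c * u n)%:E.
  rewrite sphere_momentE// -EFinM; congr EFin.
  have y2E : ((y / 2) `^ (2^-1 - k) * (y / 2) `^ (n.*2%:R + (k - 2^-1)) =
      y ^+ n.*2 / 4 ^+ n)%R.
    rewrite -powRD ?(gt_eqF y20) ?implybT//.
    rewrite (_ : 2^-1 - k + (n.*2%:R + (k - 2^-1)) = n.*2%:R)%R; last by ring.
    rewrite powR_mulrn ?(ltW y20)// expr_div_n; congr (_ / _)%R.
    by rewrite -mul2n exprM expr2 -natrM.
  have f20 : (0 < n.*2`!%:R :> R)%R by rewrite ltr0n fact_gt0.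
  have fn0 : (0 < n`!%:R :> R)%R by rewrite ltr0n fact_gt0.
  have := Gamma_gt0 (nk0 n); rewrite /c /u.
  have -> : (n%:R + k + 2^-1 = n%:R + (k - 2^-1) + 1)%R by field.
  set G := Gamma (_ + 1) => Gn0.
  transitivity (2 * Num.sqrt pi * Gamma k / (n`!%:R * G) * (y ^+ n.*2 / 4 ^+ n))%R.
    by field; rewrite !gt_eqF// exprn_gt0.
  by rewrite -y2E; ring.
have KE : K = c%:E * \sum_(n <oo) (u n)%:E.
  have -> : K = (2^-1)%:E * (K + K).
    rewrite -(fineK Kfin) -EFinD -EFinM; congr EFin; by field.
  rewrite K2; transitivity ((2^-1)%:E * ((2 * c)%:E * \sum_(n <oo) (u n)%:E)); last first.
    by rewrite muleA -EFinM; congr (_%:E * _); field.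
  congr (_ * _).
  rewrite -ge0_nneseriesZl//; last by rewrite lee_fin mulr_ge0// ltW.
  transitivity (\int[leb]_w \sum_(n <oo)
      ((2 * y ^+ n.*2 / n.*2`!%:R)%:E * (f w * w ^+ n.*2)%:E)).
    apply: eq_integral => w _; rewrite -ge0_nneseriesZl//.
    - by apply: eq_eseriesr => n _; rewrite -!EFinM term.
    - by rewrite lee_fin mulr_ge0.
    - by move=> n; rewrite lee_fin divr_ge0// exprn_even_ge0// odd_double.
  have fw0 n w : (0 <= f w * w ^+ n.*2)%R.
    by rewrite mulr_ge0// exprn_even_ge0// odd_double.
  have y2n n : (0 <= 2 * y ^+ n.*2 / n.*2`!%:R)%R.
    by rewrite divr_ge0// mulr_ge0// exprn_ge0// ltW.
  have mfw n : measurable_fun setT (fun w => (f w * w ^+ n.*2)%:E).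
    by apply/measurable_EFinP; apply: measurable_funM => //; exact: measurable_funX.
  rewrite integral_nneseries//; last 2 first.
  - by move=> n; apply: emeasurable_funM => //; exact: mfw.
  - by move=> n w _; rewrite mule_ge0// lee_fin.
  apply: eq_eseriesr => n _; rewrite ge0_integralZl//; last 3 first.
  - exact: mfw.
  - by move=> w _; rewrite lee_fin.
  - by rewrite lee_fin.
have sE : \sum_(n <oo) (u n)%:E = (fine K / c)%:E.
  rewrite mulrC EFinM fineK// KE muleA -EFinM mulVf ?gt_eqF// mul1e//.
rewrite KE sE -EFinM; congr EFin; congr (_ * _)%R.
by rewrite -(nneseries_limn_series sE).
Qed.

(** With t = z (1 + w) / 2, the exponents -(b - a) t and -(b + a)(z - t) add up to -b z + a z w, so
    [integral_expR_sphere] applies with y = a z. *)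
Lemma mckay_pdfE mu a b z : (- 2^-1 < mu)%R -> (0 < a)%R -> (a < b)%R -> (0 < z)%R ->
  \int[leb]_t (gamma_pdf (mu + 2^-1) (b - a) t * gamma_pdf (mu + 2^-1) (b + a) (z - t))%:E
  = (mckay_pdf mu a b z)%:E.
Proof.
move=> hmu a0 ab z0; set k := (mu + 2^-1)%R.
have k0 : (0 < k)%R by rewrite /k; lra.
have z20 : (0 < z / 2)%R by rewrite divr_gt0.
have ba0 : (0 < b - a)%R by rewrite subr_gt0.
have bpa0 : (0 < b + a)%R by lra.
have az0 : (0 < a * z)%R by rewrite mulr_gt0.
have Gk0 := Gamma_gt0 k0.
have g0 r t : (0 <= gamma_pdf k r t)%R by exact: gamma_pdf_ge0.
rewrite (ge0_integral_affine (z / 2)%R z20); last 2 first.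
- apply/measurable_EFinP; apply: measurable_funM; first exact: measurable_gamma_pdf.
  apply: (measurableT_comp (measurable_gamma_pdf k _)).
  exact: measurable_funB.
- by move=> t; rewrite lee_fin mulr_ge0.
pose C := ((b - a) `^ k * (b + a) `^ k / Gamma k ^+ 2 * expR (- (b * z)) *
  (z / 2) `^ (k - 1) * (z / 2) `^ (k - 1))%R.
transitivity ((z / 2)%:E * \int[leb]_w
   (C%:E * (trunc_pow k (1 - w ^+ 2) * expR (a * z * w))%:E)).
  apply: (congr1 (mule (z / 2)%:E)); apply: eq_integral => w _.
  rewrite -EFinM; congr EFin.
  rewrite -trunc_pow_1DB /C /gamma_pdf.
  have -> : (z / 2 * w + z / 2 = z / 2 * (1 + w))%R by ring.
  have -> : (z - z / 2 * (1 + w) = z / 2 * (1 - w))%R by field.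
  rewrite !trunc_powZ//.
  transitivity ((b - a) `^ k * (b + a) `^ k / Gamma k ^+ 2 *
    (expR (- (b * z)) * expR (a * z * w)) *
    (z / 2) `^ (k - 1) * (z / 2) `^ (k - 1) *
    (trunc_pow k (1 + w) * trunc_pow k (1 - w)))%R; last by ring.
  rewrite -expRD (_ : - (b * z) + a * z * w =
    - ((b - a) * (z / 2 * (1 + w))) + - ((b + a) * (z / 2 * (1 - w))))%R; last by field.
  by rewrite expRD; field; rewrite gt_eqF.
rewrite ge0_integralZl//; last 3 first.
- apply/measurable_EFinP; apply: measurable_funM; first exact: measurable_trunc_pow_sqr.
  by apply: (measurableT_comp (@measurable_expR R)); exact: measurable_funM.
- by move=> w _; rewrite lee_fin mulr_ge0 ?trunc_pow_ge0 ?expR_ge0.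
- by rewrite lee_fin !mulr_ge0 ?powR_ge0 ?expR_ge0// invr_ge0 sqr_ge0.
rewrite integral_expR_sphere// -!EFinM; congr EFin.
rewrite /mckay_pdf /C -/k.
have -> : (k - 2^-1 = mu)%R by rewrite /k; ring.
have -> : (2^-1 - k = - mu)%R by rewrite /k; ring.
(* The exponents give 1 + 2 (k - 1) = 2 mu. One power (z/2)^mu cancels against (a z / 2)^(-mu); the
   other leaves z^mu and part of (2 a)^mu. *)
have zE : (z / 2 * (z / 2) `^ (k - 1) * (z / 2) `^ (k - 1) =
    (z / 2) `^ mu * (z / 2) `^ mu)%R.
  rewrite -{1}(powRr1 (ltW z20)) -!powRD ?(gt_eqF z20) ?implybT//.
  by congr (_ `^ _)%R; rewrite /k; field.
have z2E : ((z / 2) `^ mu = z `^ mu / 2 `^ mu)%R.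
  rewrite powRM ?ltW// -powR_inv1// -powRrM mulN1r powRN//.
have aE : ((a * z / 2) `^ (- mu) = (a `^ mu)^-1 * ((z / 2) `^ mu)^-1)%R.
  by rewrite -mulrA powRM ?(ltW a0) ?(ltW z20)// !powRN.
have bE : ((b ^+ 2 - a ^+ 2) `^ k = (b - a) `^ k * (b + a) `^ k)%R.
  by rewrite -powRM ?(ltW ba0) ?(ltW bpa0)//; congr (_ `^ _)%R; ring.
rewrite bE aE (powRM _ (ler0n _ 2) (ltW a0)).
transitivity ((b - a) `^ k * (b + a) `^ k / Gamma k ^+ 2 * expR (- (b * z)) *
   (z / 2 * (z / 2) `^ (k - 1) * (z / 2) `^ (k - 1)) *
   (Num.sqrt pi * Gamma k * ((a `^ mu)^-1 * ((z / 2) `^ mu)^-1) *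
    besselI mu (a * z)))%R; first by ring.
rewrite zE z2E.
have := powR_gt0 mu z0; have := powR_gt0 mu a0; have := powR_gt0 mu (ltr0n R 2).
move: Gk0 => /[swap] /[swap] /[swap].
move: (2 `^ mu)%R (a `^ mu)%R (z `^ mu)%R ((b - a) `^ k)%R ((b + a) `^ k)%R (Gamma k)
  (besselI mu _) (expR _) (Num.sqrt pi) => p2 pa pz q1 q2 G I e s p20 pa0 pz0 G0.
by field; rewrite (gt_eqF p20) (gt_eqF pa0) (gt_eqF pz0) (gt_eqF G0).
Qed.

End bessel.

(** * The McKay law *)

Theorem theorem1 (R : realType) (mu a b : R) :
  - 2^-1 < mu -> 0 < a -> a < b ->
  exists P : real_law R,
    [/\ has_density_on `]0, +oo[ (mckay_pdf mu a b) P,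
        infinitely_divisible P,
        self_decomposable P
      & generalized_gamma_convolution P].
Proof.
move=> hmu a0 ab; pose k := mu + 2^-1.
have k0 : 0 < k by rewrite /k; lra.
have ba0 : 0 < b - a by rewrite subr_gt0.
have bpa0 : 0 < b + a by lra.
have [P Pg] := gamma_law k0 ba0; have [Q Qg] := gamma_law k0 bpa0.
exists (conv P Q); split.
- move=> A mA.
  pose h (x : R) : \bar R := (\1_A x : R)%:E.
  have mh : measurable_fun setT h by apply/measurable_EFinP; exact: measurable_indic.
  have h0 x : (0 <= h x)%E by rewrite lee_fin.
  have -> : conv P Q A = (\int[conv P Q]_x h x)%E by rewrite integral_indic// setIT.
  rewrite (integral_conv P Q mh h0) (pdf_conv Pg _ _ Qg _ _ mh h0).
  + rewrite /h integral_mkcond [RHS]integral_mkcond; apply: eq_integral => z _.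
    rewrite !patchE in_setT in_setI indicE.
    case: (z \in A); last by rewrite mul0e.
    rewrite mul1e mem_setE in_itv/= andbT; case: ifPn => [z0|].
      exact: mckay_pdfE.
    (* For z <= 0 one of t and z - t is nonpositive, so the convolution vanishes off the
       half-line. *)
    rewrite -leNgt => z0; apply: integral0_eq => t _.
    have [t0|t0] := leP t 0; first by rewrite gamma_pdf_le0// mul0r.
    by rewrite [X in _ * X]gamma_pdf_le0 ?mulr0//; lra.
  + exact: measurable_gamma_pdf.
  + by move=> x; exact: gamma_pdf_ge0.
  + exact: measurable_gamma_pdf.
  + by move=> x; exact: gamma_pdf_ge0.
- exact: infinitely_divisible_gamma2 k0 ba0 bpa0 Pg Qg.
- apply: self_decomposableP => c c01; apply: decomposable_conv.
  + exact: decomposable_gamma c01 k0 ba0 Pg.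
  + exact: decomposable_gamma c01 k0 bpa0 Qg.
- exact: ggc_gamma2 k0 ba0 bpa0 Pg Qg.
Qed.
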